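(* Let $F$ be a finite extension of $\mathbf{Q}_p$ with ring of integers $\mathcal{O}$, uniformizer $\varpi$, and residue field of cardinality $q$. Let $A=\mathbf{C}[X_1^{\pm1},X_2^{\pm1}]$ and let $Q(A)$ be its field of fractions. Let $B\subseteq \mathrm{GL}_2$ be the upper triangular Borel subgroup with modular character $\delta_B$, and let $\chi: B(F)\to A^\times$ be the unramified character $\chi\left(\left[\begin{smallmatrix} \varpi^a u_1 & x\\ & \varpi^b u_2\end{smallmatrix}\right]\right)=X_1^aX_2^b$ for $u_1,u_2\in\mathcal{O}^\times$, $x\in F$. Define $$i_{Q(A)}(\chi)=\{f:\mathrm{GL}_2(F)\to Q(A) \text{ locally constant}: f(bg)=(\delta_B^{1/2}\chi)(b)f(g)\ \forall b\in B(F), g\in \mathrm{GL}_2(F)\},$$ and let $i_A(\chi)\subseteq i_{Q(A)}(\chi)$ be the $A$-submodule of those $f$ taking values in $A$. Let $f^{\mathrm{sph}}\in i_A(\chi)$ be given by $f^{\mathrm{sph}}(bk)=(\chi\delta_B^{1/2})(b)$ for $b\in B(F)$, $k\in\mathrm{GL}_2(\mathcal{O})$. Embed $\mathrm{GL}_1\hookrightarrow\mathrm{GL}_2$ via $a\mapsto \mathrm{diag}(a,1)$. Let $l_A$ be the unique $Q(A)$-linear form in $\mathrm{Hom}_{\mathrm{GL}_1(F)}(i_{Q(A)}(\chi),Q(A))$ satisfying $l_A(f^{\mathrm{sph}})=1-q^{-1}X_1X_2^{-1}$. Then the $A$-module $l_A(i_A(\chi))$ is exactly the non-free $A$-submodule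 of $A$ $$(1-q^{-1/2}X_1)A+(1-q^{-1}X_1X_2^{-1})A=(1-q^{1/2}X_2)A+(1-q^{-1}X_1X_2^{-1})A\subseteq A.$$ In particular, $l_A(i_A(\chi))\subseteq A$, and for any $a\in A$ with $a\notin A^\times$, $a^{-1}l_A(i_A(\chi))$ is not contained in $A$.
   Context: $\delta_B\left(\left[\begin{smallmatrix} t_1 & x\\ & t_2\end{smallmatrix}\right]\right)=|t_1/t_2|$ with $|\varpi|=q^{-1}$, and $q^{1/2}$ denotes the positive square root. The space $\mathrm{Hom}_{\mathrm{GL}_1(F)}(i_{Q(A)}(\chi),Q(A))$ of $Q(A)$-linear forms invariant under the action of $\mathrm{diag}(a,1)$, $a\in F^\times$ (acting by right translation), is one-dimensional over $Q(A)$ and every nonzero element is nonvanishing on $f^{\mathrm{sph}}$, so $l_A$ is well defined. *)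

(* Defs.v *)
From HB Require Import structures.
From mathcomp Require Import all_boot all_order all_algebra all_field.
From mathcomp Require Import boolp classical_sets functions cardinality reals.
From mathcomp Require Import complex ring.

Set Implicit Arguments.
Unset Strict Implicit.
Unset Printing Implicit Defensive.

Import Order.TTheory GRing.Theory Num.Theory.

Local Open Scope classical_set_scope.
Local Open Scope ring_scope.

(* Classical units and inverses, used to equip the two rings built below with
   the unitRingType interface. *)
Section ClassicalUnits.
Variable R : comNzRingType.

Definition cunit : {pred R} := fun x => `[< exists y, y * x = 1 >].
Definition cinv (x : R) : R := if x \in cunit then xget 0 [set y | y * x = 1] else x.

Lemma cmulVr : {in cunit, left_inverse 1 cinv *%R}.
Proof.
move=> x ux; rewrite /cinv ux.
by case: xgetP => // nex; move/asboolP: ux => [y yx]; case: (nex y).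
Qed.

Lemma cunitPl (x y : R) : y * x = 1 -> x \in cunit.
Proof. by move=> yx; apply/asboolP; exists y. Qed.

Lemma cinv_out : {in [predC cunit], cinv =1 id}.
Proof. by move=> x; rewrite inE /= /cinv => /negbTE ->. Qed.

End ClassicalUnits.

(* The p-adic integers Z_p as the inverse limit of the rings Z/p^n; the class
   in Z/p^n is represented by its least nonnegative representative. *)
Section PadicIntegers.
Variables (p : nat) (p_pr : prime p).
Local Open Scope nat_scope.

Definition padic_coherent (x : nat -> nat) : Prop :=
  forall n, x n = x n.+1 %% p ^ n.

Record padic_int_of (pr : prime p) := PadicInt {
  padic_seq :> nat -> nat;
  padic_seqP : `[< padic_coherent padic_seq >] }.

HB.instance Definition _ (pr : prime p) := [isSub for @padic_seq pr].
HB.instance Definition _ (pr : prime p) := [Choice of padic_int_of pr by <:].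

Local Notation Zp := (padic_int_of p_pr).

Lemma padic_reduce_subproof (f : nat -> nat) :
    (forall n, f n.+1 = f n %[mod p ^ n]) ->
  `[< padic_coherent (fun n => f n %% p ^ n) >].
Proof.
move=> hf; apply/asboolP => n.
by rewrite modn_dvdm ?hf// expnS dvdn_mull.
Qed.

Definition padic_reduce f hf : Zp := PadicInt p_pr (@padic_reduce_subproof f hf).

Lemma padicP (x y : Zp) : (forall n, x n = y n) -> x = y.
Proof. by move=> xy; apply/val_inj/funext. Qed.

Lemma padicE (x : Zp) n : x n = x n.+1 %% p ^ n.
Proof. by have /asboolP := padic_seqP x; exact. Qed.

Lemma padic_mod (x : Zp) n : x n %% p ^ n = x n.
Proof. by rewrite padicE modn_mod. Qed.

Lemma padic_modS (x : Zp) n : x n.+1 = x n %[mod p ^ n].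
Proof. by rewrite [x n]padicE modn_mod. Qed.

Lemma padic_modD (x : Zp) n k : x (k + n) %% p ^ n = x n.
Proof.
elim: k => [|k IH]; first exact: padic_mod.
rewrite -IH (padicE x (k + n)) addSn modn_dvdm // expnD; exact: dvdn_mull.
Qed.

Fact padic_zero_subproof n : 0 = 0 %[mod p ^ n]. Proof. by []. Qed.
Fact padic_one_subproof n : 1 = 1 %[mod p ^ n]. Proof. by []. Qed.
Fact padic_add_subproof (x y : Zp) n :
  x n.+1 + y n.+1 = x n + y n %[mod p ^ n].
Proof. by rewrite -modnDm !padic_modS modnDm. Qed.
Fact padic_mul_subproof (x y : Zp) n :
  x n.+1 * y n.+1 = x n * y n %[mod p ^ n].
Proof. by rewrite -modnMm !padic_modS modnMm. Qed.

Lemma padic_lt (x : Zp) n : x n < p ^ n.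
Proof. by rewrite -padic_mod ltn_mod expn_gt0 prime_gt0. Qed.

Fact padic_opp_subproof (x : Zp) n :
  p ^ n.+1 - x n.+1 = p ^ n - x n %[mod p ^ n].
Proof.
apply/eqP; rewrite -(eqn_modDr (x n.+1)) subnK ?(ltnW (padic_lt _ _))//.
rewrite -modnDmr padic_modS modnDmr subnK ?(ltnW (padic_lt _ _))//.
by rewrite modnn expnS modnMl.
Qed.

Definition padic_zero := padic_reduce padic_zero_subproof.
Definition padic_one := padic_reduce padic_one_subproof.
Definition padic_add x y := padic_reduce (padic_add_subproof x y).
Definition padic_mul x y := padic_reduce (padic_mul_subproof x y).
Definition padic_opp x := padic_reduce (padic_opp_subproof x).

Fact padic_addA : associative padic_add.
Proof. by move=> x y z; apply: padicP => n /=; rewrite modnDml modnDmr addnA. Qed.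
Fact padic_addC : commutative padic_add.
Proof. by move=> x y; apply: padicP => n /=; rewrite addnC. Qed.
Fact padic_add0 : left_id padic_zero padic_add.
Proof. by move=> x; apply: padicP => n /=; rewrite mod0n add0n padic_mod. Qed.
Fact padic_addN : left_inverse padic_zero padic_opp padic_add.
Proof.
move=> x; apply: padicP => n /=.
by rewrite modnDml subnK ?(ltnW (padic_lt _ _))// modnn mod0n.
Qed.
HB.instance Definition _ :=
  GRing.isZmodule.Build Zp padic_addA padic_addC padic_add0 padic_addN.

Fact padic_mulA : associative padic_mul.
Proof. by move=> x y z; apply: padicP => n /=; rewrite modnMml modnMmr mulnA. Qed.
Fact padic_mulC : commutative padic_mul.
Proof. by move=> x y; apply: padicP => n /=; rewrite mulnC. Qed.
Fact padic_mul1 : left_id padic_one padic_mul.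
Proof. by move=> x; apply: padicP => n /=; rewrite modnMml mul1n padic_mod. Qed.
Fact padic_mulD : left_distributive padic_mul padic_add.
Proof.
by move=> x y z; apply: padicP => n /=; rewrite modnMml modnDm mulnDl.
Qed.
Fact padic_1neq0 : padic_one != padic_zero.
Proof.
apply/eqP => /(congr1 (fun x : Zp => x 1)) /=.
by rewrite expn1 mod0n modn_small ?prime_gt1.
Qed.
HB.instance Definition _ := GRing.Zmodule_isComNzRing.Build Zp
  padic_mulA padic_mulC padic_mul1 padic_mulD padic_1neq0.

HB.instance Definition _ := GRing.ComNzRing_hasMulInverse.Build Zp
  (@cmulVr Zp) (@cunitPl Zp) (@cinv_out Zp).

Fact padic_dvd (x : Zp) n k : p ^ n %| x (k + n) -> x n = 0.
Proof. by move/eqP; rewrite padic_modD. Qed.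

Fact padic_mulf_eq0 (x y : Zp) :
  (x * y = 0)%R -> (x == 0%R) || (y == 0%R).
Proof.
move=> xy0; apply/norP => -[x0 y0].
have nz (z : Zp) : z != 0%R -> exists n, z n != 0.
  apply: contra_neqP => /forallNP zn; apply: padicP => n /=.
  by rewrite mod0n; have := zn n; case: eqP.
have [i xi] := nz x x0; have [j yj] := nz y y0.
have xij : ~~ (p ^ i %| x (j + i)) by apply: contra xi => /padic_dvd ->.
have yij : ~~ (p ^ j %| y (i + j)) by apply: contra yj => /padic_dvd ->.
have xpos : 0 < x (j + i) by rewrite lt0n; apply: contraNneq xij => ->.
have ypos : 0 < y (i + j) by rewrite lt0n; apply: contraNneq yij => ->.
have : p ^ (i + j) %| x (i + j) * y (i + j).
  by apply/eqP; have := congr1 (fun z : Zp => z (i + j)) xy0; rewrite /= mod0n.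
move: xij xpos; rewrite (addnC j) => xij xpos.
rewrite !pfactor_dvdn ?muln_gt0 ?xpos// in xij yij *.
rewrite -ltnNge in xij; rewrite -ltnNge in yij.
by rewrite lognM// leqNgt -addSn leq_add // ltnW.
Qed.
HB.instance Definition _ := GRing.ComUnitRing_isIntegral.Build Zp padic_mulf_eq0.

End PadicIntegers.

Notation padic_int p_pr := (@padic_int_of _ p_pr).
Notation padic_field p_pr := {fraction (padic_int p_pr)}.


Notation "x %:F" := (@FracField.tofrac _ x) : ring_scope.

(* The ring of integers of a finite extension F of Q_p is the integral closure
   of Z_p in F. *)
Section LocalField.
Variables (p : nat) (p_pr : prime p) (F : fieldExtType (padic_field p_pr)).

Definition integers : set F :=
  [set x | integralOver (fun a : padic_int p_pr => (a%:F)%:A : F) x].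

Definition integer_units : set F :=
  [set x | [/\ x != 0, integers x & integers x^-1]].

Definition maximal_ideal : set F := integers `\` integer_units.

Definition uniformizer (varpi : F) : Prop :=
  maximal_ideal = [set varpi * x | x in integers].

(* The underlying set of the residue field: the cosets x + maximal_ideal. *)
Definition residue_field : set (set F) :=
  [set [set y | maximal_ideal (y - x)] | x in integers].

(* The integer n with x = varpi ^ n * u, u a unit; junk value for x = 0. *)
Definition ord (varpi x : F) : int :=
  xget 0 [set n : int | integer_units (x / varpi ^ n)].

Definition absval (R : realType) (varpi : F) (q : nat) (x : F) : R :=
  if x == 0 then 0 else q%:R ^ (- ord varpi x).

End LocalField.

Arguments integers {p p_pr} F.
Arguments residue_field {p p_pr} F.

Section GL2.
Variable F : fieldType.

Record GL2 := MkGL2 { GL2_mx :> 'M[F]_2; GL2_unit : GL2_mx \in unitmx }.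

HB.instance Definition _ := [isSub for GL2_mx].
HB.instance Definition _ := [Choice of GL2 by <:].

Fact GL2_one_subproof : (1%:M : 'M[F]_2) \in unitmx.
Proof. exact: unitmx1. Qed.
Fact GL2_mul_subproof (g h : GL2) : g *m h \in unitmx.
Proof. by rewrite unitmx_mul !GL2_unit. Qed.
Fact GL2_inv_subproof (g : GL2) : invmx g \in unitmx.
Proof. by rewrite unitmx_inv GL2_unit. Qed.

Definition GL2_one := MkGL2 GL2_one_subproof.
Definition GL2_mul g h := MkGL2 (GL2_mul_subproof g h).
Definition GL2_inv g := MkGL2 (GL2_inv_subproof g).

Fact GL2_mulA : associative GL2_mul.
Proof. by move=> g h k; apply: val_inj; rewrite /= mulmxA. Qed.
Fact GL2_mul1g : left_id GL2_one GL2_mul.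
Proof. by move=> g; apply: val_inj; rewrite /= mul1mx. Qed.
Fact GL2_mulg1 : right_id GL2_one GL2_mul.
Proof. by move=> g; apply: val_inj; rewrite /= mulmx1. Qed.
Fact GL2_mulVg : left_inverse GL2_one GL2_inv GL2_mul.
Proof. by move=> g; apply: val_inj; rewrite /= mulVmx ?GL2_unit. Qed.
Fact GL2_mulgV : right_inverse GL2_one GL2_inv GL2_mul.
Proof. by move=> g; apply: val_inj; rewrite /= mulmxV ?GL2_unit. Qed.
HB.instance Definition _ := isGroup.Build GL2
  GL2_mulA GL2_mul1g GL2_mulg1 GL2_mulVg GL2_mulgV.

Fact GL1_embed_subproof (a : F) : a != 0 ->
  diag_mx (\row_(j < 2) if j == 0 then a else 1) \in unitmx.
Proof.
by move=> a0; rewrite unitmxE det_diag big_ord_recl big_ord1 !mxE/= mulr1 unitfE.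
Qed.
Definition GL1_embed (a : F) (a0 : a != 0) : GL2 := MkGL2 (GL1_embed_subproof a0).

Definition borel : set GL2 := [set b | b 1 0 = 0].

End GL2.

Definition GL2_integers (p : nat) (p_pr : prime p)
    (F : fieldExtType (padic_field p_pr)) : set (GL2 F) :=
  [set k : GL2 F | (forall i j, integers F (k i j)) /\ integer_units (\det k)].

(* The Laurent polynomial ring k[X1^{+-1}, X2^{+-1}], as the subring of the
   rational function field k(X1, X2) of all P / (X1^m X2^n), P in k[X1, X2]. *)
Section Laurent.
Variable k : fieldType.

Local Notation ratfun2 := {fraction {poly {poly k}}}.

Definition ratfun_X1 : ratfun2 := ('X%:P : {poly {poly k}})%:F.
Definition ratfun_X2 : ratfun2 := ('X : {poly {poly k}})%:F.

Definition laurent_pred : {pred ratfun2} := fun x =>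
  `[< exists m n (P : {poly {poly k}}), x = P%:F / (ratfun_X1 ^+ m * ratfun_X2 ^+ n) >].

Fact ratfun_X1_neq0 : ratfun_X1 != 0.
Proof. by rewrite /ratfun_X1 tofrac_eq0 polyC_eq0 polyX_eq0. Qed.
Fact ratfun_X2_neq0 : ratfun_X2 != 0.
Proof. by rewrite /ratfun_X2 tofrac_eq0 polyX_eq0. Qed.

Fact laurent_poly (P : {poly {poly k}}) : P%:F \in laurent_pred.
Proof. by apply/asboolP; exists 0%N, 0%N, P; rewrite mulr1 divr1. Qed.

Fact frac_sub_subproof (K : fieldType) (x y a b : K) (m n m' n' : nat) :
    a != 0 -> b != 0 ->
  x / (a ^+ m * b ^+ n) - y / (a ^+ m' * b ^+ n') =
  (x * (a ^+ m' * b ^+ n') - y * (a ^+ m * b ^+ n)) /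
    ((a ^+ m * a ^+ m') * (b ^+ n * b ^+ n')).
Proof. by move=> a0 b0; field; rewrite !expf_neq0. Qed.

Fact frac_mul_subproof (K : fieldType) (x y a b : K) (m n m' n' : nat) :
  x / (a ^+ m * b ^+ n) * (y / (a ^+ m' * b ^+ n')) =
  x * y / ((a ^+ m * a ^+ m') * (b ^+ n * b ^+ n')).
Proof. by rewrite mulf_div mulrACA. Qed.

Fact laurent_subring : subring_closed laurent_pred.
Proof.
have x1 := ratfun_X1_neq0; have x2 := ratfun_X2_neq0.
split=> [|x y|x y]; first by rewrite -tofrac1 laurent_poly.
- move=> /asboolP [m [n [P ->]]] /asboolP [m' [n' [Q ->]]]; apply/asboolP.
  exists (m + m')%N, (n + n')%N,
    (P * ('X%:P ^+ m' * 'X ^+ n') - Q * ('X%:P ^+ m * 'X ^+ n)).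
  rewrite tofracB !tofracM !tofracXn -/ratfun_X1 -/ratfun_X2 !exprD.
  rewrite (frac_sub_subproof _ _ _ _ _ _ x1 x2). reflexivity.
- move=> /asboolP [m [n [P ->]]] /asboolP [m' [n' [Q ->]]]; apply/asboolP.
  exists (m + m')%N, (n + n')%N, (P * Q).
  by rewrite tofracM !exprD frac_mul_subproof.
Qed.
HB.instance Definition _ :=
  GRing.isSubringClosed.Build ratfun2 laurent_pred laurent_subring.

Record laurent := MkLaurent {
  laurent_val :> ratfun2; laurent_valP : laurent_val \in laurent_pred }.

HB.instance Definition _ := [isSub for laurent_val].
HB.instance Definition _ := [Choice of laurent by <:].
HB.instance Definition _ := [SubChoice_isSubComNzRing of laurent by <:].

HB.instance Definition _ := GRing.ComNzRing_hasMulInverse.Build laurent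
  (@cmulVr laurent) (@cunitPl laurent) (@cinv_out laurent).

Fact laurent_mulf_eq0 (x y : laurent) : x * y = 0 -> (x == 0) || (y == 0).
Proof.
move=> /(congr1 val); rewrite rmorphM rmorph0 => /eqP.
by rewrite mulf_eq0 -!(inj_eq val_inj) rmorph0.
Qed.
HB.instance Definition _ :=
  GRing.ComUnitRing_isIntegral.Build laurent laurent_mulf_eq0.

Definition laurentC (c : k) : laurent := MkLaurent (laurent_poly c%:P%:P).
Definition laurent_X1 : laurent := MkLaurent (laurent_poly 'X%:P).
Definition laurent_X2 : laurent := MkLaurent (laurent_poly 'X).

Fact laurent_X1_unit : laurent_X1 \is a GRing.unit.
Proof.
have V : ratfun_X1^-1 \in laurent_pred.
  by apply/asboolP; exists 1%N, 0%N, 1; rewrite rmorph1 mulr1 expr1 div1r.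
apply: (@cunitPl _ _ (MkLaurent V)).
by apply: val_inj; rewrite /= mulVf ?ratfun_X1_neq0.
Qed.

Fact laurent_X2_unit : laurent_X2 \is a GRing.unit.
Proof.
have V : ratfun_X2^-1 \in laurent_pred.
  by apply/asboolP; exists 0%N, 1%N, 1; rewrite rmorph1 div1r expr0 mul1r expr1.
apply: (@cunitPl _ _ (MkLaurent V)).
by apply: val_inj; rewrite /= mulVf ?ratfun_X2_neq0.
Qed.

End Laurent.

Section Freeness.
Variables (A : nzRingType) (V : lmodType A).

Definition module_basis (M B : set V) : Prop :=
  [/\ B `<=` M,
      forall x, M x -> exists2 s : seq V, (forall v, v \in s -> B v) &
        exists c : V -> A, x = \sum_(v <- s) c v *: v
    & forall (s : seq V) (c : V -> A), uniq s -> (forall v, v \in s -> B v) ->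
        \sum_(v <- s) c v *: v = 0 -> forall v, v \in s -> c v = 0].

Definition free_submodule (M : set V) : Prop := exists B, module_basis M B.

End Freeness.

Definition ideal2 (A : comNzRingType) (x y : A) : set A :=
  [set z | exists a b, z = x * a + y * b].

Section PrincipalSeries.
Variables (R : realType) (p : nat) (p_pr : prime p).
Variables (F : fieldExtType (padic_field p_pr)) (varpi : F) (q : nat).

Local Notation A := (laurent R[i]).
Local Notation QA := {fraction A}.
Local Notation absval := (absval R varpi q).

(* The square root of the modular character delta_B(b) = |t1 / t2| and the
   unramified character chi; both are only meaningful on the Borel subgroup. *)
Definition sqrt_delta (b : GL2 F) : R := Num.sqrt (absval (b 0 0 / b 1 1)).

Definition chi (b : GL2 F) : A :=
  laurent_X1 _ ^ ord varpi (b 0 0) * laurent_X2 _ ^ ord varpi (b 1 1).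

Definition delta_chi (b : GL2 F) : A := laurentC (sqrt_delta b)%:C%C * chi b.

(* Locally constant for the topology on GL_2(F) induced from F^4. *)
Definition locally_constant (T : Type) (f : GL2 F -> T) : Prop :=
  forall g : GL2 F, exists2 e : R, 0 < e &
    forall h : GL2 F, (forall i j, absval (h i j - g i j) < e) -> f h = f g.

Definition iQ_pred : {pred (GL2 F -> QA^o)} := fun f =>
  `[< locally_constant f /\
      forall b g, borel b -> f (b * g)%g = (delta_chi b)%:F * f g >].

Fact iQ_submod : submod_closed iQ_pred.
Proof.
split; first by apply/asboolP; split=> [g|b g _]; [exists 1 | rewrite mulr0].
move=> a f f' /asboolP [fl fB] /asboolP [fl' fB']; apply/asboolP; split=> [g|b g Bb].
  have [e e0 fe] := fl g; have [e' e0' fe'] := fl' g.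
  exists (Num.min e e'); first by rewrite lt_min e0.
  move=> h hg; rewrite /GRing.add /GRing.scale /= fe ?fe'// => i j.
    by have := hg i j; rewrite lt_min => /andP[].
  by have := hg i j; rewrite lt_min => /andP[].
by rewrite /GRing.add/= /GRing.scale/= fB// fB'// mulrDr mulrCA.
Qed.
HB.instance Definition _ :=
  GRing.isSubmodClosed.Build QA (GL2 F -> QA^o) iQ_pred iQ_submod.

Record iQ := MkIQ { iQ_fun :> GL2 F -> QA^o; iQ_funP : iQ_fun \in iQ_pred }.
HB.instance Definition _ := [isSub for iQ_fun].
HB.instance Definition _ := [Choice of iQ by <:].
HB.instance Definition _ := [SubChoice_isSubLmodule of iQ by <:].

Definition iA : set iQ := [set f | forall g, exists a : A, f g = a%:F].

Definition spherical (f : iQ) : Prop :=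
  forall b k, borel b -> GL2_integers k -> f (b * k)%g = (delta_chi b)%:F.

(* Invariance under right translation by GL_1(F): f' is the translate of f. *)
Definition GL1_invariant (l : iQ -> QA) : Prop :=
  forall (a : F) (a0 : a != 0) (f f' : iQ),
    (forall g, f' g = f (g * GL1_embed a0)%g) -> l f' = l f.

End PrincipalSeries.

Arguments iA R {p p_pr F} varpi q.

(* Main.v *)
(* Write a = q^(-1/2) X1, b = q^(1/2) X2, u = 1 - a/b, and use the coordinate
   x of the lower unipotent matrix [1, 0; x, 1] on B\GL2 minus the point at
   infinity. Over Q(A), the combination of fsph and its translate by
   diag(varpi^-1, 1) that cancels off the maximal ideal is (1 - b/a) times the
   section supported on the maximal ideal; its translates give the sections E_n
   supported on varpi^n O. Invariance and l(fsph) = u then force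
   l(E_n) = a^n (1 - b^-1).

   Conversely, let f be A-valued. As O is compact (Koenig's lemma and
   completeness), f is invariant under 1 + varpi^M O for some M, so averaging
   over representatives of O^* modulo 1 + varpi^M O makes it O^*-invariant
   without changing l(f). Subtracting f(w) fsph, with w the point at infinity,
   leaves a finite A-combination of the E_n. Hence the image of l is (u, 1 - b^-1).

   O is shown to be a discrete valuation ring from the principality of its
   maximal ideal alone: if varpi^n divides p, then 1, varpi, ..., varpi^(n-1)
   are linearly independent over Q_p, so n <= [F : Q_p].

   The ideal (1 - a, 1 - b) is proper, but a common divisor of its generators
   is a unit, so it is not free. *)

From HB Require Import structures.
Require Import Defs.
From mathcomp Require Import all_boot all_order all_algebra all_field.
From mathcomp Require Import boolp classical_sets functions cardinality reals.
From mathcomp Require Import complex ring zify.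

Set Implicit Arguments.
Unset Strict Implicit.
Unset Printing Implicit Defensive.

Import Order.TTheory GRing.Theory Num.Theory.

Local Open Scope classical_set_scope.
Local Open Scope card_scope.
Local Open Scope ring_scope.

(** * The p-adic integers *)

Lemma fraction_quotient (D : idomainType) (x : {fraction D}) :
  exists a b : D, b != 0 /\ x = a%:F / b%:F.
Proof.
elim/quotW: x => r; exists (frac r).1, (frac r).2; split; first exact: denom_ratioP.
have d0 := denom_ratioP r.
apply: (@mulIf _ (frac r).2%:F); first by rewrite tofrac_eq0.
rewrite mulfVK ?tofrac_eq0//.
unlock FracField.tofrac.
rewrite [_ * _]piE /=.
apply/eqmodP; rewrite /= FracField.equivfE /FracField.mulf.
by rewrite !numden_Ratio ?mulr1 ?oner_neq0//; rewrite mulrC.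
Qed.

Lemma common_denominator (D : idomainType) (n : nat) (c : 'I_n -> {fraction D}) :
  exists (b : D) (a : 'I_n -> D), b != 0 /\ forall i, c i * b%:F = (a i)%:F.
Proof.
have /choice[f fP] i : exists ab : D * D, ab.2 != 0 /\ c i = ab.1%:F / ab.2%:F.
  by have [a [b [b0 e]]] := fraction_quotient (c i); exists (a, b).
exists (\prod_i (f i).2), (fun i => (f i).1 * \prod_(j | j != i) (f j).2); split.
  by apply/prodf_neq0 => i _; have [] := fP i.
move=> i; have [f0 ->] := fP i.
by rewrite (bigD1 i)//= !tofracM mulrA mulfVK ?tofrac_eq0.
Qed.

Section PadicDivisibility.
Variables (p : nat) (p_pr : prime p).
Local Notation Zp := (padic_int p_pr).

Lemma padic_natE (m n : nat) : (m%:R : Zp) n = (m %% p ^ n)%N.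
Proof.
elim: m => [|m IH]; first by rewrite /= mod0n.
by rewrite -addn1 natrD /= IH modnDm.
Qed.

(** The quotient is the shifted sequence [x (k + n) %/ p ^ n]: dividing by [p ^ n] costs n levels of
    precision, hence the shift. *)
Lemma padic_dvdP (x : Zp) n : x n = 0%N -> exists y : Zp, x = p%:R ^+ n * y.
Proof.
move=> xn0; have pn0 : (0 < p ^ n)%N by rewrite expn_gt0 prime_gt0.
have dv k : (p ^ n %| x (k + n)%N)%N by apply/eqP; rewrite padic_modD.
have hf k : ((x (k.+1 + n) %/ p ^ n) = (x (k + n) %/ p ^ n) %[mod p ^ k])%N.
  rewrite [x (k + n)%N]padicE addSn.
  rewrite {1}(divn_eq (x (k + n).+1) (p ^ (k + n))) expnD mulnA divnMDl//.
  by rewrite -modnDml modnMl add0n.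
exists (padic_reduce p_pr hf); apply: padicP => k.
rewrite -natrX /= padic_natE modnMml modnMmr mulnC divnK//.
by rewrite addnC padic_modD.
Qed.

Lemma padic_p_neq0 : (p%:R : Zp) != 0.
Proof.
(* Level 2 is the first at which the residue of p is nonzero. *)
apply/eqP => /(congr1 (fun z : Zp => z 2)); rewrite padic_natE /= mod0n.
rewrite modn_small ?(ltn_Pmull (prime_gt1 p_pr)) ?expnS ?expn1 ?prime_gt0// => p0.
by move: p_pr; rewrite p0.
Qed.

(** Bezout gives an inverse at each level, and uniqueness of inverses modulo [p ^ n] makes these
    choices coherent. *)
Lemma padic_unitP (x : Zp) : x 1%N != 0%N -> x \is a GRing.unit.
Proof.
move=> x1.
have cop n : coprime (x n) (p ^ n).
  case: n => [|n]; first by rewrite coprimen1.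
  rewrite coprime_pexpr// coprime_sym prime_coprime//.
  by apply: contra x1 => /eqP dv; rewrite -(padic_modD _ 1 n) addn1 expn1 dv.
have xpos n : (0 < n)%N -> (0 < x n)%N.
  case: n => // n _; rewrite lt0n; apply: contra x1 => /eqP x0.
  by rewrite -(padic_modD _ 1 n) addn1 x0 mod0n.
have /choice[g gP] n : exists g : nat, (x n * g = 1 %[mod p ^ n])%N.
  case: n => [|n]; first by exists 0%N; rewrite !modn1.
  have [km kn e _] := egcdnP (p ^ n.+1) (xpos n.+1 isT).
  exists km; rewrite mulnC e.
  by have := cop n.+1; rewrite /coprime => /eqP ->; rewrite -modnDml modnMl add0n.
have hf n : (g n.+1 = g n %[mod p ^ n])%N.
  have e1 : (x n * g n.+1 = 1 %[mod p ^ n])%N.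
    rewrite -modnMml padicE modn_mod modnMml.
    by have := congr1 (modn^~ (p ^ n)%N) (gP n.+1); rewrite !modn_dvdm ?dvdn_exp2l.
  rewrite -[g n.+1]mul1n -modnMml -(gP n) modnMml mulnAC -modnMml e1 modnMml.
  by rewrite mul1n.
apply: (@cunitPl _ _ (padic_reduce p_pr hf)); apply: padicP => n /=.
by rewrite modnMml mulnC gP.
Qed.

Lemma padic_factor (x : Zp) : x != 0 ->
  exists n u, u \is a GRing.unit /\ x = p%:R ^+ n * u.
Proof.
move=> x0; have /existsNP[n0 /eqP xn0] : ~ forall n, x n = 0%N.
  by move=> xz; move/eqP: x0; apply; apply: padicP => n; rewrite xz /= mod0n.
(* The residue at level 0 is always 0, so the least level with nonzero residue is a successor n + 1;
   n is then the valuation. *)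
case: (ex_minnP (ex_intro (fun n => x n != 0%N) n0 xn0)) => [[|n]] xn min.
  by have := padic_lt x 0; rewrite expn0 ltnS leqn0 (negbTE xn).
have /padic_dvdP[u xE] : x n = 0%N.
  by apply/eqP; apply: contraT => /min; rewrite ltnn.
exists n, u; split=> //; apply: padic_unitP.
apply: contra xn => /eqP/padic_dvdP[v uE].
have xE' : x = p%:R ^+ n.+1 * v by rewrite xE uE expr1 exprSr mulrA.
by rewrite xE' -natrX /= padic_natE modnn mul0n mod0n.
Qed.

Lemma padic_p_not_unit (x : Zp) : p%:R * x != 1.
Proof.
apply/eqP => /(congr1 (fun z : Zp => z 1%N)).
by rewrite /= padic_natE expn1 modnn mul0n mod0n modn_small ?prime_gt1.
Qed.

Lemma padic_pX_eq0 (x : Zp) : (forall n, exists y, x = p%:R ^+ n * y) -> x = 0.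
Proof.
move=> xp; apply: padicP => n; have [y ->] := xp n.
by rewrite -natrX /= padic_natE modnn mul0n.
Qed.

(** Level n of the limit is read off the n-th partial sum, since all later terms vanish modulo
    [p ^ n]. *)
Lemma padic_series (b : nat -> Zp) : exists a : Zp,
  forall n, exists r, a = \sum_(i < n) p%:R ^+ i * b i + p%:R ^+ n * r.
Proof.
pose S n : Zp := \sum_(i < n) p%:R ^+ i * b i.
have hf n : (S n.+1 n.+1 = S n n %[mod p ^ n])%N.
  rewrite padic_modS /S big_ord_recr -/(S n) /= -natrX padic_natE.
  by rewrite modnn mul0n mod0n addn0 !modn_mod.
exists (padic_reduce p_pr hf) => n.
have [|r rE] := @padic_dvdP (padic_reduce p_pr hf - S n) n.
  by rewrite /= modnDml modnDmr subnKC ?modnn// ltnW// padic_lt.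
by exists r; rewrite -/(S n) -rE addrC subrK.
Qed.

End PadicDivisibility.

(** * Integral elements of the extension *)

Section RingOfIntegers.
Variables (p : nat) (p_pr : prime p) (F : fieldExtType (padic_field p_pr)).
Local Notation Zp := (padic_int p_pr).

(** The structure map with respect to which [integers] is the integral closure, named so that it can
    carry the structure of a ring morphism. *)
Definition padic_embed (a : Zp) : F := (a%:F)%:A.
Fact padic_embed_zmod_morphism : zmod_morphism padic_embed.
Proof. by move=> a b; rewrite /padic_embed tofracB scalerBl. Qed.
Fact padic_embed_monoid_morphism : monoid_morphism padic_embed.
Proof.
split=> [|a b]; rewrite /padic_embed ?tofrac1 ?scale1r// tofracM.
by rewrite -scalerAl mul1r scalerA.
Qed.
HB.instance Definition _ :=
  GRing.isZmodMorphism.Build Zp F padic_embed padic_embed_zmod_morphism.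
HB.instance Definition _ :=
  GRing.isMonoidMorphism.Build Zp F padic_embed padic_embed_monoid_morphism.
Local Notation iota := padic_embed.

Lemma padic_embed_eq0 a : (iota a == 0) = (a == 0).
Proof. by rewrite scaler_eq0 oner_eq0 orbF tofrac_eq0. Qed.

Lemma integersE x : integers F x = integralOver iota x.
Proof. by []. Qed.

Lemma integers_embed a : integers F (iota a).
Proof. by rewrite integersE; apply: integral_id. Qed.
Lemma integers0 : integers F 0.
Proof. by rewrite integersE; apply: integral0. Qed.
Lemma integers1 : integers F 1.
Proof. by rewrite integersE; apply: integral1. Qed.
Lemma integersN x : integers F x -> integers F (- x).
Proof. by rewrite !integersE; apply: integral_opp. Qed.
Lemma integersD x y : integers F x -> integers F y -> integers F (x + y).
Proof. by rewrite !integersE; apply: integral_add. Qed.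
Lemma integersB x y : integers F x -> integers F y -> integers F (x - y).
Proof. by rewrite !integersE; apply: integral_sub. Qed.
Lemma integersM x y : integers F x -> integers F y -> integers F (x * y).
Proof. by rewrite !integersE; apply: integral_mul. Qed.
Lemma integersX x n : integers F x -> integers F (x ^+ n).
Proof.
move=> xO; elim: n => [|n IH]; first exact: integers1.
by rewrite exprS; apply: integersM.
Qed.
Lemma integers_sum (I : Type) (r : seq I) (P : pred I) (f : I -> F) :
  (forall i, P i -> integers F (f i)) -> integers F (\sum_(i <- r | P i) f i).
Proof. by move=> fO; apply: big_ind => //; [exact: integers0|exact: integersD]. Qed.

Lemma padic_p_neq0_ext : (p%:R : F) != 0.
Proof. by rewrite -(rmorph_nat iota) padic_embed_eq0 padic_p_neq0. Qed.

(** Multiplying a monic equation of degree d for 1/p by [p ^ d] gives 1 + p s = 0 with s in Z_p, but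
    p is not invertible there. *)
Lemma integers_p_inv : ~ integers F (p%:R^-1 : F).
Proof.
rewrite integersE => -[P Pm /rootP]; rewrite horner_coef size_map_poly_id0; last first.
  by rewrite (monicP Pm) rmorph1 oner_eq0.
have cm i : (map_poly iota P)`_i = iota P`_i by exact: coef_map.
have P0 : (0 < size P)%N by rewrite size_poly_gt0 monic_neq0.
rewrite -(prednK P0) big_ord_recr /=.
set d := (size P).-1 => /(congr1 (fun z => z * p%:R ^+ d)).
have pd0 : (p%:R ^+ d : F) != 0 by rewrite expf_neq0 ?padic_p_neq0_ext.
rewrite mul0r mulrDl cm -lead_coefE (monicP Pm) rmorph1 mul1r exprVn mulVf//.
rewrite mulr_suml.
have -> : \sum_(i < d) (map_poly iota P)`_i * p%:R^-1 ^+ i * p%:R ^+ d =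
   iota (p%:R * \sum_(i < d) P`_i * p%:R ^+ (d.-1 - i)).
  rewrite mulr_sumr rmorph_sum; apply: eq_bigr => i _.
  rewrite cm !rmorphM rmorphXn !rmorph_nat mulrCA -exprS -mulrA; congr (_ * _).
  have e : d = (i + (d.-1 - i).+1)%N.
    case: i => i /= id; move: id; case: (d) => // k.
    by rewrite ltnS => ik; rewrite addnS subnKC.
  have -> : p%:R ^+ d = p%:R ^+ i * p%:R ^+ (d.-1 - i).+1 :> F by rewrite -exprD -e.
  by rewrite exprVn mulKf ?expf_neq0 ?padic_p_neq0_ext.
rewrite -(rmorph1 iota) -rmorphD => /eqP; rewrite padic_embed_eq0 addr_eq0.
move=> /eqP e; have := padic_p_not_unit (- (\sum_(i < d) P`_i * p%:R ^+ (d.-1 - i))).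
by rewrite mulrN e opprK eqxx.
Qed.

(** Too many powers for the dimension give a linear relation over Q_p; a common denominator moves
    its coefficients to Z_p. *)
Lemma powers_dependent (x : F) n : (\dim (fullv : {vspace F}) < n)%N ->
  exists a : 'I_n -> Zp,
    (exists i, a i != 0) /\ \sum_(i < n) iota (a i) * x ^+ i = 0.
Proof.
move=> dn; pose X := [tuple x ^+ i | i < n].
have nfree : ~~ free X.
  apply: contraL dn => /eqP e; rewrite -leqNgt -[X in (X <= _)%N](size_tuple X) -e.
  exact/dimvS/subvf.
have [c cX [i ci]] : exists2 c : 'I_n -> padic_field p_pr,
    \sum_(i < n) c i *: X`_i = 0 & exists i, c i != 0.
  apply: contrapT => H; move/negP: nfree; apply; apply/freeP => c cX i.
  by apply/eqP; apply: contrapT => /negP ci; apply: H; exists c => //; exists i.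
have [b [a [b0 cE]]] := common_denominator c.
exists a; split.
  exists i; apply/eqP => ai0; have /eqP := cE i.
  by rewrite ai0 tofrac0 mulf_eq0 (negbTE ci) orFb tofrac_eq0 (negbTE b0).
transitivity (b%:F *: \sum_(i < n) c i *: X`_i); last by rewrite cX scaler0.
rewrite scaler_sumr; apply: eq_bigr => j _.
by rewrite (nth_mktuple _ _ j) scalerA [_ * c j]mulrC cE -mulr_algl.
Qed.

(** Take D to be the leading coefficient of a polynomial over Z_p killing x. Multiplying the
    equation by a power of D makes it monic in D x. *)
Lemma integers_denominator (x : F) :
  exists2 D : Zp, D != 0 & integers F (iota D * x).
Proof.
have [a [[i0 ai0] ax]] := powers_dependent x (ltnSn _).
set n := (\dim fullv).+1 in a i0 ai0 ax.
pose P := \poly_(i < n) (if insub i is Some j then a j else 0).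
have Pa (i : 'I_n) : P`_i = a i by rewrite coef_poly ltn_ord valK.
have P0 : P != 0 by apply: contra ai0 => /eqP P0; rewrite -Pa P0 coef0.
have Px : \sum_(i < size P) iota P`_i * x ^+ i = 0.
  rewrite -[RHS]ax; under [RHS]eq_bigr do rewrite -Pa.
  have sP : (size P <= n)%N by exact: size_poly.
  rewrite (big_ord_widen n (fun i => iota P`_i * x ^+ i) sP) big_mkcond.
  apply: eq_bigr => i _; case: ltnP => // Pi.
  by rewrite nth_default// rmorph0 mul0r.
have D0 : lead_coef P != 0 by rewrite lead_coef_eq0.
exists (lead_coef P) => //; move: Px; have sP0 : (0 < size P)%N by rewrite size_poly_gt0.
rewrite -(prednK sP0) big_ord_recr /= -lead_coefE.
set D := lead_coef P in D0 *; case: (size P).-1 => [|d].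
  (* Degree 0 is excluded, since a nonzero constant has no root. *)
  rewrite big_ord0 add0r expr0 mulr1 => /eqP.
  by rewrite (padic_embed_eq0 D) (negbTE D0).
(* The degree being d + 1, the equation is multiplied by [D ^ d], which splits as
   [D ^ (d - i) * D ^ i]; the second part is absorbed into [(D x) ^ i]. *)
move=> Px; pose q := \poly_(i < d.+1) iota (P`_i * D ^+ (d - i)).
have sq : (size q < size ('X^(d.+1) : {poly F})%R)%N.
  by rewrite size_polyXn ltnS size_poly.
pose Q := 'X^(d.+1) + q.
rewrite integersE; apply: (@integral_root_monic _ _ iota _ Q).
- by rewrite monicE lead_coefDl// lead_coefXn.
- apply/rootP; rewrite hornerD hornerXn horner_poly.
  transitivity (iota D ^+ d *
    (\sum_(i < d.+1) iota P`_i * x ^+ i + iota D * x ^+ d.+1)); last first.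
    by rewrite Px mulr0.
  rewrite mulrDr addrC; congr (_ + _); last by rewrite exprMn exprSr mulrA.
  rewrite mulr_sumr; apply: eq_bigr => i _.
  have -> : iota D ^+ d = iota D ^+ (d - i) * iota D ^+ i.
    by rewrite -exprD subnK // -ltnS.
  rewrite rmorphM rmorphXn exprMn.
  by rewrite [X in X * _ = _]mulrC mulrACA.
- have [+ _] := integral_poly iota Q. apply=> i; rewrite coefD coefXn coef_poly.
  apply: integral_add; first by case: (_ == _); [exact: integral1|exact: integral0].
  by case: ifP => _; [exact: integral_id|exact: integral0].
Qed.

End RingOfIntegers.

(** * The valuation *)

Section Uniformizer.
Variables (p : nat) (p_pr : prime p) (F : fieldExtType (padic_field p_pr)).
Variables (varpi : F) (varpi_unif : uniformizer varpi).
Local Notation Zp := (padic_int p_pr).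
Local Notation iota := (padic_embed F).

Lemma integer_units_int x : integer_units x -> integers F x.
Proof. by case. Qed.

Lemma integer_units_neq0 (x : F) : integer_units x -> x != 0.
Proof. by case. Qed.

Lemma integer_units1 : integer_units (1 : F).
Proof. by split; rewrite ?invr1 ?oner_neq0//; exact: integers1. Qed.

Lemma integer_unitsM (x y : F) :
  integer_units x -> integer_units y -> integer_units (x * y).
Proof.
move=> [x0 xO xVO] [y0 yO yVO]; split; first by rewrite mulf_neq0.
  exact: integersM.
by rewrite invfM; apply: integersM.
Qed.

Lemma integer_unitsV (x : F) : integer_units x -> integer_units x^-1.
Proof. by move=> [x0 xO xVO]; split; rewrite ?invr_eq0 ?invrK. Qed.

Lemma integer_unitsX (x : F) n : integer_units x -> integer_units (x ^+ n).
Proof.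
move=> ux; elim: n => [|n IH]; first exact: integer_units1.
by rewrite exprS; apply: integer_unitsM.
Qed.

Lemma uniformizerP x : integers F x ->
  integer_units x \/ exists2 y, integers F y & x = varpi * y.
Proof.
move=> xO; have [ux|nux] := pselect (integer_units x); [by left|right].
have : maximal_ideal x by split.
by rewrite varpi_unif => -[y yO <-]; exists y.
Qed.

Lemma uniformizer_not_unit y : integers F y -> ~ integer_units (varpi * y).
Proof.
move=> yO; suff [] : maximal_ideal (varpi * y) by [].
by rewrite varpi_unif; exists y.
Qed.

Lemma uniformizer_int : integers F varpi.
Proof.
suff [] : maximal_ideal varpi by [].
by rewrite varpi_unif; exists 1; rewrite ?mulr1//; exact: integers1.
Qed.

Lemma p_not_unit : ~ integer_units (p%:R : F).
Proof. by case=> _ _; apply: integers_p_inv. Qed.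

Lemma uniformizer_dvd_p : exists2 y, integers F y & (p%:R : F) = varpi * y.
Proof.
have := @uniformizerP p%:R; case=> //; last by move/p_not_unit.
by rewrite -(rmorph_nat iota); apply: integers_embed.
Qed.

Lemma uniformizer_neq0 : varpi != 0.
Proof.
apply/eqP => v0; have [y _ /eqP] := uniformizer_dvd_p.
by rewrite v0 mul0r (negbTE (padic_p_neq0_ext F)).
Qed.
Local Notation varpi0 := uniformizer_neq0.

(** The fractional ideal generated by [varpi ^ n], n of either sign, stated by division so that no
    valuation is presupposed. *)
Definition ideal_pow (n : int) : set F := [set x | integers F (x / varpi ^ n)].

Lemma uniformizer_exp_neq0 (n : int) : varpi ^ n != 0.
Proof. by rewrite expfz_neq0 ?varpi0. Qed.

Lemma ideal_pow0P x : ideal_pow 0 x <-> integers F x.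
Proof. by rewrite /ideal_pow /= expr0z divr1. Qed.

Lemma ideal_powD n x y : ideal_pow n x -> ideal_pow n y -> ideal_pow n (x + y).
Proof. by rewrite /ideal_pow /= mulrDl; apply: integersD. Qed.

Lemma ideal_powN n x : ideal_pow n x -> ideal_pow n (- x).
Proof. by rewrite /ideal_pow /= mulNr; apply: integersN. Qed.

Lemma ideal_powB n x y : ideal_pow n x -> ideal_pow n y -> ideal_pow n (x - y).
Proof. by rewrite /ideal_pow /= mulrBl; apply: integersB. Qed.

Lemma ideal_pow_0 n : ideal_pow n 0.
Proof. by rewrite /ideal_pow /= mul0r; apply: integers0. Qed.

Lemma ideal_pow_sum n (I : Type) (r : seq I) (P : pred I) (f : I -> F) :
  (forall i, P i -> ideal_pow n (f i)) -> ideal_pow n (\sum_(i <- r | P i) f i).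
Proof.
by move=> fO; apply: big_ind => //; [exact: ideal_pow_0|exact: ideal_powD].
Qed.

Lemma ideal_powM m n x y :
  ideal_pow m x -> ideal_pow n y -> ideal_pow (m + n) (x * y).
Proof.
rewrite /ideal_pow /= expfzDr ?varpi0// -mulf_div; exact: integersM.
Qed.

Lemma ideal_powMl n x y : integers F x -> ideal_pow n y -> ideal_pow n (x * y).
Proof. by move=> /ideal_pow0P xO yn; rewrite -[n]add0r; apply: ideal_powM. Qed.

Lemma ideal_pow_exp n : ideal_pow n (varpi ^ n).
Proof.
by rewrite /ideal_pow /= divff ?uniformizer_exp_neq0//; apply: integers1.
Qed.

Lemma ideal_pow_le m n x : m <= n -> ideal_pow n x -> ideal_pow m x.
Proof.
move=> mn xn; have [k nE] : exists k : nat, n = m + k%:Z.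
  by exists `|n - m|%N; rewrite gez0_abs ?subr_ge0// [RHS]addrC subrK.
have -> : x = varpi ^+ k * (x / varpi ^+ k).
  by rewrite mulrC divfK// expf_neq0// varpi0.
apply: ideal_powMl; first exact/integersX/uniformizer_int.
by move: xn; rewrite nE /ideal_pow /= expfzDr ?varpi0// invfM mulrA mulrAC.
Qed.

Lemma ideal_powP (n : nat) x :
  ideal_pow n x <-> exists2 y, integers F y & x = varpi ^+ n * y.
Proof.
split=> [xn|[y yO ->]].
  by exists (x / varpi ^+ n) => //; rewrite mulrC divfK// expf_neq0// varpi0.
by rewrite /ideal_pow /= mulrC mulKf// expf_neq0// varpi0.
Qed.

(** An element of Z_p outside p Z_p is a unit of Z_p, hence of O, and so avoids the maximal
    ideal. *)
Lemma padic_in_ideal a : ideal_pow 1 (iota a) -> exists b, a = p%:R * b.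
Proof.
move=> /(ideal_powP 1)[y yO aE].
have [/padic_dvdP[b ->]|/eqP a1] := pselect (a 1%N = 0%N); first by exists b.
have ua := padic_unitP a1.
case: (@uniformizer_not_unit y yO); rewrite -[varpi]expr1 -aE; split.
- by rewrite padic_embed_eq0; apply: contraTneq ua => ->; rewrite unitr0.
- exact: integers_embed.
- suff -> : (iota a)^-1 = iota a^-1 by exact: integers_embed.
  by rewrite rmorphV.
Qed.

(* The dominant term of such a sum is its first one with a unit coefficient. *)
Lemma padic_span_powers (n : nat) (a : 'I_n -> Zp) :
  ideal_pow n (p%:R : F) -> \sum_(i < n) iota (a i) * varpi ^+ i = 0 ->
  forall i, exists b, a i = p%:R * b.
Proof.
move=> pn a0; suff H k (i : 'I_n) : (i < k)%N -> exists b, a i = p%:R * b.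
  by move=> i; apply: (H n).
elim: k i => // k IH i; rewrite ltnS leq_eqVlt => /orP[/eqP ik|]; last exact: IH.
apply: padic_in_ideal.
have : ideal_pow k.+1 (iota (a i) * varpi ^+ i).
  move: a0; rewrite (bigD1 i)//= => /eqP; rewrite addr_eq0 => /eqP ->.
  apply/ideal_powN/ideal_pow_sum => j ji.
  (* Earlier coefficients are divisible by p, hence by [varpi ^ n] with n > k; later terms carry a
     power of varpi beyond k. *)
  have [jk|jk] := ltnP j k.
    have [b ->] := IH _ jk; rewrite rmorphM rmorph_nat -mulrA mulrC.
    apply: ideal_powMl; first exact/integersM/integersX/uniformizer_int/integers_embed.
    apply: ideal_pow_le pn; rewrite lez_nat -ik; exact: ltn_ord.
  apply: ideal_powMl; first exact: integers_embed.
  apply: (@ideal_pow_le _ j%:Z); last exact: ideal_pow_exp.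
  rewrite lez_nat ltn_neqAle jk andbT -ik eq_sym; exact: ji.
rewrite /ideal_pow /= ik -exprnP exprS expr1z invfM mulrA mulrAC mulfK//.
by rewrite expf_neq0// varpi0.
Qed.

(** Infinite descent: a relation among the [varpi ^ i], i < n, has all coefficients divisible by p,
    and dividing by p leaves a relation of the same kind. So the coefficients are divisible by every
    power of p and vanish. *)
Lemma ideal_pow_p_bound (n : nat) :
  ideal_pow n (p%:R : F) -> (n <= \dim (fullv : {vspace F}))%N.
Proof.
move=> pn; rewrite leqNgt; apply/negP => nd.
have [a [[i0 ai0] a0]] := powers_dependent varpi nd.
suff [b bE] : exists b : nat -> 'I_n -> Zp, forall k i, a i = p%:R ^+ k * b k i.
  case/eqP: ai0; apply: padic_pX_eq0 => k; exists (b k i0); exact: bE.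
(* The quotient relation is kept in the induction so that the division can be repeated. *)
suff H k : exists b : 'I_n -> Zp, (forall i, a i = p%:R ^+ k * b i) /\
    \sum_(i < n) iota (b i) * varpi ^+ i = 0.
  have /choice[b bP] k := H k; exists b => k; by have [] := bP k.
elim: k => [|k [b [aE b0]]]; first by exists a; split=> // i; rewrite mul1r.
have /choice[c cP] i := padic_span_powers pn b0 i.
exists c; split=> [i|]; first by rewrite aE cP exprSr mulrA.
apply: (@mulfI _ (p%:R : F)); first exact: padic_p_neq0_ext.
rewrite mulr0 -[RHS]b0 mulr_sumr; apply: eq_bigr => i _.
by rewrite (cP i) rmorphM rmorph_nat mulrA.
Qed.

(** The dimension bound gives a largest e with [varpi ^ e] dividing p; by maximality the cofactor is
    a unit. This e is the ramification index. *)
Lemma p_ramification :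
  exists e u, [/\ (0 < e)%N, integer_units u & (p%:R : F) = varpi ^+ e * u].
Proof.
pose P n := `[< ideal_pow n%:Z (p%:R : F) >].
have Pex : exists n, P n.
  exists 0%N; apply/asboolP/ideal_pow0P.
  by rewrite -(rmorph_nat iota); apply: integers_embed.
have Pb n : P n -> (n <= \dim (fullv : {vspace F}))%N.
  by move/asboolP/ideal_pow_p_bound.
case: (ex_maxnP Pex Pb) => e /asboolP/(ideal_powP e)[u uO pE] emax.
have uu : integer_units u.
  have [//|[y yO uE]] := uniformizerP uO.
  suff : (e.+1 <= e)%N by rewrite ltnn.
  apply/emax/asboolP/(ideal_powP e.+1); exists y => //.
  by rewrite pE uE exprSr mulrA.
exists e, u; split=> //; rewrite lt0n; apply/eqP => e0; apply: p_not_unit.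
by rewrite pE e0 mul1r.
Qed.

(** The factorization of p spreads to Z_p, then to O, because a nonzero integer divides a nonzero
    element of Z_p, and to F by clearing denominators. *)
Lemma unit_factor (x : F) : x != 0 ->
  exists (n : int) u, integer_units u /\ x = varpi ^ n * u.
Proof.
(* A factor in O of [varpi ^ N * u] is itself a power of varpi times a unit: cancel one varpi at a
   time. *)
have H N (y z u : F) : integers F y -> integers F z -> integer_units u ->
    y * z = varpi ^+ N * u -> exists (n : nat) v, integer_units v /\ y = varpi ^+ n * v.
  elim: N y => [|N IH] y yO zO uu yz.
    exists 0%N, y; rewrite mul1r; split=> //; move: yz; rewrite mul1r => yz.
    have := integer_units_neq0 uu; rewrite -yz mulf_eq0 negb_or => /andP[y0 z0].
    split=> //; have -> : y^-1 = z * u^-1 by rewrite -yz invfM mulrCA divff// mulr1.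
    by apply: integersM => //; case: uu.
  have [uy|[y' yO' yE]] := uniformizerP yO; first by exists 0%N, y; rewrite mul1r.
  have [|n [v [vu vE]]] := IH y' yO' zO uu.
    by apply: (mulfI varpi0); rewrite mulrA -yE yz exprS mulrA.
  by exists n.+1, v; split=> //; rewrite yE vE exprS mulrA.
have K (D : Zp) : D != 0 -> exists (n : nat) v, integer_units v /\ iota D = varpi ^+ n * v.
  move=> /padic_factor[k [w [uw ->]]].
  have [e [u [_ uu pE]]] := p_ramification.
  exists (e * k)%N, (u ^+ k * iota w); split.
    apply: integer_unitsM; first exact: integer_unitsX.
    split; [|exact: integers_embed|].
      by rewrite padic_embed_eq0; apply: contraTneq uw => ->; rewrite unitr0.
    suff -> : (iota w)^-1 = iota w^-1 by exact: integers_embed.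
    by rewrite rmorphV.
  by rewrite rmorphM rmorphXn rmorph_nat pE exprMn exprM mulrA.
(* A denominator D of 1/y makes y a divisor of D in O. *)
have L (y : F) : integers F y -> y != 0 ->
    exists (n : nat) v, integer_units v /\ y = varpi ^+ n * v.
  move=> yO y0; have [D D0 DO] := integers_denominator y^-1.
  have [n [v [uv vE]]] := K D D0.
  by apply: (H n y (iota D * y^-1) v yO DO uv); rewrite mulrCA divff// mulr1.
move=> x0; have [D D0 DO] := integers_denominator x.
have [n [v [uv vE]]] := K D D0.
have [|m [w [uw wE]]] := L _ DO; first by rewrite mulf_neq0// padic_embed_eq0.
exists (m%:Z - n%:Z), (w * v^-1); split.
  exact/integer_unitsM/integer_unitsV.
apply: (@mulfI _ (iota D)); first by rewrite padic_embed_eq0.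
rewrite wE vE expfzDr ?varpi0// -invr_expz -!exprnP.
have v0 := integer_units_neq0 uv.
rewrite mulrACA [varpi ^+ n * _]mulrC divfK ?expf_neq0 ?varpi0//.
by rewrite [v * _]mulrC divfK.
Qed.

Lemma uniformizer_exp_unit (n : int) : integer_units (varpi ^ n) -> n = 0.
Proof.
have H (k : nat) : ~ integer_units (varpi ^+ k.+1).
  rewrite exprS; apply: uniformizer_not_unit.
  exact/integersX/uniformizer_int.
case: n => [[//|k]|k]; first by move/H.
by rewrite NegzE -invr_expz => /integer_unitsV; rewrite invrK => /H.
Qed.

(** [ord] selects some exponent with the defining property; two such exponents differ by the
    exponent of a power of varpi that is a unit, hence by 0. *)
Lemma ordE (n : int) u : integer_units u -> ord varpi (varpi ^ n * u) = n.
Proof.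
move=> uu; rewrite /ord; case: xgetP => [m _ /= um|/(_ n)]; last first.
  by case; rewrite /= mulrAC divff ?mul1r// uniformizer_exp_neq0.
apply/esym/eqP; rewrite -subr_eq0; apply/eqP/uniformizer_exp_unit.
rewrite expfzDr ?varpi0// -invr_expz.
have := integer_unitsM um (integer_unitsV uu).
by rewrite mulrAC mulfK// integer_units_neq0.
Qed.

Lemma ord_unit u : integer_units u -> ord varpi u = 0.
Proof. by move=> uu; rewrite -[u]mul1r -(expr0z varpi) ordE. Qed.

Lemma ord_one : ord varpi 1 = 0.
Proof. exact/ord_unit/integer_units1. Qed.

Lemma ord_uniformizer_exp (n : int) : ord varpi (varpi ^ n) = n.
Proof. by rewrite -[_ ^ _]mulr1 ordE//; exact: integer_units1. Qed.

Lemma ordM x y : x != 0 -> y != 0 -> ord varpi (x * y) = ord varpi x + ord varpi y.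
Proof.
move=> /unit_factor[m [u [uu ->]]] /unit_factor[n [v [uv ->]]].
by rewrite mulrACA -expfzDr ?varpi0// !ordE//; apply: integer_unitsM.
Qed.

Lemma ordV x : x != 0 -> ord varpi x^-1 = - ord varpi x.
Proof.
move=> x0; have : x^-1 != 0 by rewrite invr_eq0.
move=> /ordM/(_ x0); rewrite mulVf// ord_one => /esym/eqP.
by rewrite addr_eq0 => /eqP.
Qed.

Lemma ideal_pow_ord (n : int) x : x != 0 -> ideal_pow n x <-> n <= ord varpi x.
Proof.
move=> x0; have [m [u [uu xE]]] := unit_factor x0; rewrite xE ordE//; split=> [xn|nm].
  rewrite leNgt; apply/negP => mn.
  (* If m < n, then [varpi ^ (n - m)] would be integral together with its inverse. *)
  suff /uniformizer_exp_unit/eqP : integer_units (varpi ^ (n - m)).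
    by rewrite subr_eq0 => /eqP nm; rewrite nm ltxx in mn.
  split; first exact: uniformizer_exp_neq0.
    apply/ideal_pow0P/ideal_pow_le/ideal_pow_exp; first by rewrite subr_ge0 ltW.
  have -> : (varpi ^ (n - m))^-1 = varpi ^ m * u / varpi ^ n * u^-1.
    rewrite mulrAC mulfK ?(integer_units_neq0 uu)// invr_expz opprB.
    by rewrite expfzDr ?varpi0// -invr_expz.
  by apply: integersM => //; case: uu.
apply: ideal_pow_le nm _; rewrite mulrC.
exact/ideal_powMl/ideal_pow_exp/integer_units_int.
Qed.

End Uniformizer.

(** * Residue field, completeness and compactness *)

Section ResidueField.
Variables (p : nat) (p_pr : prime p) (F : fieldExtType (padic_field p_pr)).
Variables (varpi : F) (varpi_unif : uniformizer varpi).
Variables (q : nat) (q_card : residue_field F #= `I_q).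
Local Notation Zp := (padic_int p_pr).
Local Notation iota := (padic_embed F).
Local Notation ideal_pow := (ideal_pow varpi).
Local Notation varpi0 := (uniformizer_neq0 varpi_unif).

Lemma maximal_idealE : @maximal_ideal p p_pr F = ideal_pow 1.
Proof.
rewrite varpi_unif; apply/seteqP; split=> x.
  by case=> y yO <-; apply/(ideal_powP varpi_unif 1); exists y.
by case/(ideal_powP varpi_unif 1) => y yO ->; exists y.
Qed.

(** Otherwise y and y - x, hence also x, would be multiples of varpi. *)
Lemma integer_unit_add (x y : F) :
  integer_units x -> ideal_pow 1 (y - x) -> integer_units y.
Proof.
move=> ux yx; have yO : integers F y.
  rewrite -[y](subrK x); apply: integersD; last exact: integer_units_int.
  exact/(ideal_pow0P varpi)/(ideal_pow_le varpi_unif _ yx).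
have [//|/(ideal_powP varpi_unif 1) y1] := uniformizerP varpi_unif yO.
have : ideal_pow 1 x by rewrite -[x](subKr y); exact: ideal_powB.
case/(ideal_powP varpi_unif 1) => z zO xE; case: (uniformizer_not_unit varpi_unif zO).
by rewrite -[varpi]expr1 -xE.
Qed.

Lemma residue_card_gt1 : (1 < q)%N.
Proof.
have /card_set_bijP[f [fsub finj _]] := q_card.
pose coset (x : F) := [set y | maximal_ideal (y - x)].
have c0 : residue_field F (coset 0) by exists 0 => //; exact: integers0.
have c1 : residue_field F (coset 1) by exists 1 => //; exact: integers1.
rewrite ltnNge; apply/negP => q1.
(* If q <= 1, the bijection with the numbers below q can only take the value 0, which identifies the
   cosets of 0 and 1. *)
have fz C : residue_field F C -> f C = 0%N.
  move=> /fsub /= fC; apply/eqP; rewrite -leqn0 -ltnS; exact: leq_trans fC q1.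
have e : coset 0 = coset 1 by apply: finj; rewrite ?inE ?fz.
have : coset 1 1 by rewrite /coset /= maximal_idealE subrr; apply: ideal_pow_0.
by rewrite -e /coset /= subr0 => -[_ []]; exact: integer_units1.
Qed.

Lemma residue_representatives : exists m (s : 'I_m -> F),
  (forall j, integers F (s j)) /\
  forall x, integers F x -> exists j, ideal_pow 1 (x - s j).
Proof.
have /finite_seqP[L LE] : finite_set (residue_field F).
  by apply/finite_setP; exists q.
have /choice[f fP] (C : set F) : exists x : F, residue_field F C ->
    integers F x /\ C = [set y | maximal_ideal (y - x)].
  have [[x xO <-]|nC] := pselect (residue_field F C); last by exists 0.
  by exists x.
exists (size L), (fun j => f (nth set0 L j)); split=> [j|x xO].
  have [|//] := fP (nth set0 L j); rewrite LE /=; exact: mem_nth.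
have Cx : residue_field F [set y | maximal_ideal (y - x)] by exists x.
have : [set y | maximal_ideal (y - x)] \in L by move: Cx; rewrite LE.
move=> /(nthP set0)[i iL Li]; exists (Ordinal iL); rewrite /= Li.
have [_ /seteqP[sub _]] := fP _ Cx; rewrite -maximal_idealE.
by apply: sub; rewrite /= subrr maximal_idealE; exact: ideal_pow_0.
Qed.

(** The remainder is again integral, so its residue supplies the next digit. *)
Lemma digit_expansion m (s : 'I_m -> F) :
    (forall x, integers F x -> exists j, ideal_pow 1 (x - s j)) ->
  forall k x, integers F x -> exists (d : nat -> 'I_m) (r : F),
    integers F r /\ x = \sum_(i < k) s (d i) * varpi ^+ i + varpi ^+ k * r.
Proof.
move=> sP; elim=> [|k IH] x xO.
  have [j _] := sP 0 (integers0 F); exists (fun=> j), x; split=> //.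
  by rewrite big_ord0 add0r mul1r.
have [d [r [rO ->]]] := IH x xO.
have [j /(ideal_powP varpi_unif 1)[r' rO' rE]] := sP r rO.
exists (fun i => if i == k then j else d i), r'; split=> //.
rewrite big_ord_recr /= eqxx -addrA; congr (_ + _).
  by apply: eq_bigr => i _; rewrite ltn_eqF.
by rewrite -[r](subrK (s j)) rE mulrDr mulrA -exprSr addrC [s j * _]mulrC.
Qed.

(** Since p is [varpi ^ e] times a unit, the first e digits determine an integer modulo p. This
    finite generation modulo p is what transfers completeness from Z_p to O. *)
Lemma padic_generators : exists (J : finType) (g : J -> F),
  (forall j, integers F (g j)) /\
  forall x, integers F x -> exists (a : J -> Zp) (r : F),
    integers F r /\ x = \sum_j iota (a j) * g j + p%:R * r.
Proof.
have [e [u [e0 uu pE]]] := p_ramification varpi_unif.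
have [m [s [sO sP]]] := residue_representatives.
exists ('I_e * 'I_m)%type, (fun j : 'I_e * 'I_m => s j.2 * varpi ^+ j.1); split=> [j|x xO].
  exact/integersM/integersX/uniformizer_int.
have [d [r [rO ->]]] := digit_expansion sP e xO.
(* The coefficients are 0 or 1: at each position they select the generator of the digit that occurs
   there. *)
exists (fun j : 'I_e * 'I_m => (d j.1 == j.2)%:R), (u^-1 * r); split.
  by apply: integersM => //; case: uu.
rewrite pE -mulrA mulVKf ?integer_units_neq0//; congr (_ + _).
rewrite -(pair_bigA _ (fun (i : 'I_e) (j : 'I_m) => iota (d i == j)%:R * (s j * varpi ^+ i))) /=.
apply: eq_bigr => i _; rewrite (bigD1 (d i))//= eqxx rmorph1 mul1r big1 ?addr0//.
by move=> j jd; rewrite eq_sym (negbTE jd) rmorph0 mul0r.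
Qed.

(** Expanding the increments in the generators of O modulo p turns convergence into that of finitely
    many series in Z_p. *)
Lemma padic_complete (z : nat -> F) :
    (forall k, exists2 t, integers F t & z k.+1 - z k = p%:R ^+ k * t) ->
  exists y, forall k, exists2 r, integers F r & y - z k = p%:R ^+ k * r.
Proof.
move=> zP; have [J [g [gO gP]]] := padic_generators.
have /choice[t tP] k : exists t, integers F t /\ z k.+1 - z k = p%:R ^+ k * t.
  by have [t tO tE] := zP k; exists t.
have /choice[c cP] (x : F) : exists c : (J -> Zp) * F, integers F x ->
    integers F c.2 /\ x = \sum_j iota (c.1 j) * g j + p%:R * c.2.
  have [xO|nx] := pselect (integers F x); last by exists (fun=> 0, 0).
  by have [a [r aP]] := gP x xO; exists (a, r).
(* [R k] is the carry: the cofactor of p left over by one expansion is added to the next increment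
   before expanding again. *)
pose R := fix R k := if k is k'.+1 then (c (R k' + t k')).2 else 0.
have RO k : integers F (R k).
  elim: k => [|k IH]; first exact: integers0.
  by have [] := cP (R k + t k) (integersD IH (tP k).1).
pose b k j := (c (R k + t k)).1 j.
have zE k : z k = z 0%N + \sum_j iota (\sum_(i < k) p%:R ^+ i * b i j) * g j +
    p%:R ^+ k * R k.
  elim: k => [|k IH].
    by rewrite mulr0 addr0 big1 ?addr0// => j _; rewrite big_ord0 rmorph0 mul0r.
  have [_ rE] := cP (R k + t k) (integersD (RO k) (tP k).1).
  rewrite -[z k.+1](subrK (z k)) (tP k).2 [in LHS]IH.
  rewrite addrCA -mulrDr [t k + _]addrC rE -!addrA; congr (_ + _).
  rewrite mulrDr mulr_sumr addrA -big_split mulrA -exprSr /=; congr (_ + _).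
  apply: eq_bigr => j _; rewrite big_ord_recr/= rmorphD mulrDl; congr (_ + _).
  by rewrite rmorphM rmorphXn rmorph_nat mulrA.
have /choice[a aP] j := padic_series (b^~ j).
exists (z 0%N + \sum_j iota (a j) * g j) => k.
have /choice[r rP] j := aP j k.
exists (\sum_j iota (r j) * g j - R k).
  apply: integersB => //; apply: integers_sum => j _; apply: integersM => //.
  exact: integers_embed.
rewrite (zE k) mulrBr opprD addrA; congr (_ - _).
rewrite opprD addrACA subrr add0r -sumrB mulr_sumr.
apply: eq_bigr => j _.
by rewrite (rP j) rmorphD mulrDl addrAC subrr add0r rmorphM rmorphXn rmorph_nat mulrA.
Qed.

Lemma uniformizer_complete (y : nat -> F) :
    (forall n, ideal_pow n%:Z (y n.+1 - y n)) ->
  exists x, forall n, ideal_pow n%:Z (x - y n).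
Proof.
move=> yP; have [e [u [e0 uu pE]]] := p_ramification varpi_unif.
have yD n k : ideal_pow n%:Z (y (n + k)%N - y n).
  elim: k => [|k IH]; first by rewrite addn0 subrr; exact: ideal_pow_0.
  rewrite -(subrK (y (n + k)%N) (y _)) -addrA; apply: ideal_powD => //.
  rewrite addnS; apply: ideal_pow_le (yP _) => //.
  by rewrite lez_nat leq_addr.
have pk k : (p%:R : F) ^+ k = varpi ^+ (e * k) * u ^+ k.
  by rewrite pE exprMn exprM.
(* Along multiples of e the increments are divisible by powers of p, so [padic_complete] applies to
   this subsequence. *)
have [|x xP] := @padic_complete (fun k => y (e * k)%N).
  move=> k; have := yD (e * k)%N e; rewrite -mulnSr.
  move=> /(ideal_powP varpi_unif)[r rO rE]; exists (u^-1 ^+ k * r).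
    by apply: integersM => //; apply: integersX; case: uu.
  rewrite rE pk mulrA -mulrA mulrA -[_ * u^-1 ^+ k]mulrA -exprMn.
  by rewrite divff ?expr1n ?mulr1// integer_units_neq0.
exists x => n; rewrite -(subrK (y (e * n)%N) x) -addrA.
have en : (n <= e * n)%N by rewrite leq_pmull.
apply: ideal_powD; last by rewrite -(subnKC en).
have [r rO ->] := xP n; rewrite pk -mulrA.
apply: (@ideal_pow_le _ _ _ _ varpi_unif _ (e * n)%N); first by rewrite lez_nat.
apply/(ideal_powP varpi_unif); exists (u ^+ n * r) => //.
exact/integersM/rO/integersX/integer_units_int.
Qed.

(** Koenig's argument: if no N works for O, then at each level some smaller ball has none either.
    The nested balls shrink to a point, near which h is constant. *)
Lemma uniformly_locally_constant (T : Type) (h : F -> T) :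
    (forall x, integers F x -> exists N : nat,
       forall y, ideal_pow N (y - x) -> h y = h x) ->
  exists N : nat, forall x y,
    integers F x -> integers F y -> ideal_pow N (x - y) -> h x = h y.
Proof.
move=> hP; have [m [s [sO sP]]] := residue_representatives.
pose P x (n : nat) := exists M : nat, forall y z, ideal_pow n (y - x) ->
  ideal_pow n (z - x) -> ideal_pow M (y - z) -> h y = h z.
suff [M PM] : P 0 0%N.
  exists M => x y xO yO; apply: PM; rewrite subr0; exact/ideal_pow0P.
apply: contrapT => nP.
have step x n : exists x', integers F x -> ~ P x n ->
    [/\ integers F x', ideal_pow n%:Z (x' - x) & ~ P x' n.+1].
  have [xO|] := pselect (integers F x); last by exists 0.
  have [PP|nPx] := pselect (P x n); first by exists 0.
  suff [j nPj] : exists j, ~ P (x + varpi ^+ n * s j) n.+1.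
    exists (x + varpi ^+ n * s j) => _ _; split=> //.
      exact/integersD/integersM/sO/integersX/uniformizer_int.
    rewrite addrC addKr mulrC; apply: ideal_powMl => //; exact: ideal_pow_exp.
  apply/existsNP => Pj; apply: nPx.
  have /choice[M MP] j := Pj j.
  (* A modulus of at least n + 1 keeps y and z in the same sub-ball, whose own modulus then
     applies. *)
  exists (maxn n.+1 (\max_j M j)) => y z yx zx yz.
  have /(ideal_powP varpi_unif)[w wO wE] := yx.
  have [j /(ideal_powP varpi_unif 1)[r rO rE]] := sP w wO.
  have yj : ideal_pow n.+1 (y - (x + varpi ^+ n * s j)).
    apply/(ideal_powP varpi_unif n.+1); exists r => //.
    by rewrite opprD addrA wE -mulrBr rE mulrA -exprSr.
  apply: (MP j) => //.
    have -> : z - (x + varpi ^+ n * s j) = y - (x + varpi ^+ n * s j) - (y - z).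
      by rewrite opprB [RHS]addrC addrA subrK.
    apply: ideal_powB => //; apply: ideal_pow_le yz => //.
    by rewrite lez_nat leq_max leqnn.
  apply: ideal_pow_le yz => //; rewrite lez_nat leq_max.
  by rewrite (leq_bigmax j) orbT.
have /choice[f fP] (xn : F * nat) : exists x', integers F xn.1 -> ~ P xn.1 xn.2 ->
    [/\ integers F x', ideal_pow xn.2%:Z (x' - xn.1) & ~ P x' xn.2.+1].
  exact: step.
pose c := fix c n := if n is n'.+1 then f (c n', n') else 0.
have cP n : integers F (c n) /\ ~ P (c n) n.
  elim: n => [|n [cO nPc]]; first by split=> //; exact: integers0.
  by have [] := fP (c n, n) cO nPc.
have [|x xc] := @uniformizer_complete c.
  by move=> n; have [cO nPc] := cP n; have [] := fP (c n, n) cO nPc.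
have xO : integers F x.
  by apply/(ideal_pow0P varpi); have := xc 0%N; rewrite subr0.
(* Modulus 0 suffices: h is constant on the ball around [c N], as the limit x is a centre of this
   ball as well. *)
have [N hN] := hP x xO; have [_] := cP N; apply; exists 0%N => y z yN zN _.
have near w : ideal_pow N (w - c N) -> h w = h x.
  move=> wN; apply: hN; rewrite -(subrK (c N) w) -addrA; apply: ideal_powD => //.
  by rewrite -opprB; apply/ideal_powN/xc.
by rewrite !near.
Qed.

(** Multiplication by a unit u permutes the unit classes modulo [varpi ^ M]; [f] is this permutation
    on chosen representatives. *)
Lemma unit_class_representatives (M : nat) : (0 < M)%N ->
  exists m (r : 'I_m -> F), [/\ (0 < m)%N, forall i, integer_units (r i) &
    forall u, integer_units u -> exists2 f : 'I_m -> 'I_m, injective f &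
      forall i, ideal_pow M (r (f i) - r i * u)].
Proof.
move=> M0; have [m [s [sO sP]]] := residue_representatives.
have [L LP] : exists L : seq F, forall x, integers F x ->
    exists2 y, y \in L & ideal_pow M (x - y).
  exists [seq \sum_(i < M) s (d i) * varpi ^+ i | d : {ffun 'I_M -> 'I_m}].
  move=> x xO; have [d [r [rO xE]]] := digit_expansion sP M xO.
  exists (\sum_(i < M) s (d i) * varpi ^+ i).
    apply/mapP; exists [ffun i : 'I_M => d i]; first by rewrite mem_enum.
    by apply: eq_bigr => i _; rewrite ffunE.
  apply/(ideal_powP varpi_unif); exists r => //.
  by rewrite {1}xE addrAC subrr add0r.
(* The first entry of L in the class of x depends on the class alone, so congruence becomes equality
   of representatives. *)
pose rep x := nth 0 L (find (fun y => `[< ideal_pow M (x - y) >]) L).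
have repP x : integers F x -> rep x \in L /\ ideal_pow M (x - rep x).
  move=> xO; have hasx : has (fun y => `[< ideal_pow M (x - y) >]) L.
    by have [y yL xy] := LP x xO; apply/hasP; exists y => //; apply/asboolP.
  by split; [rewrite mem_nth// -has_find|apply/asboolP; exact: (nth_find 0 hasx)].
have rep_eq x y : ideal_pow M (x - y) -> rep x = rep y.
  move=> xy; rewrite /rep; congr nth; apply: eq_find => z; apply: asbool_equiv_eq.
  split=> H.
    by rewrite -[y](subKr x) addrAC; apply: ideal_powB.
  by rewrite -[x](subrK y) -addrA; apply: ideal_powD.
have M1 x : ideal_pow M x -> ideal_pow 1 x.
  by apply: ideal_pow_le => //; rewrite lez_nat.
have rep_unit x : integer_units x -> integer_units (rep x).
  move=> ux; apply: (integer_unit_add ux); rewrite -opprB; apply/ideal_powN/M1.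
  by have [] := repP x (integer_units_int ux).
pose rs : seq F := undup [seq rep x | x <- L & `[< integer_units x >]].
have rsP r : r \in rs -> integer_units r /\ rep r = r.
  rewrite mem_undup => /mapP[x]; rewrite mem_filter => /andP[/asboolP ux _] ->.
  split; first exact: rep_unit.
  apply: rep_eq; rewrite -opprB; apply: ideal_powN.
  by have [] := repP x (integer_units_int ux).
have rep_rs x : integer_units x -> rep x \in rs.
  move=> ux; have [xL xr] := repP x (integer_units_int ux).
  rewrite mem_undup; apply/mapP; exists (rep x); last exact: rep_eq.
  by rewrite mem_filter xL andbT; apply/asboolP/rep_unit.
pose r (i : 'I_(size rs)) := nth 0 rs i.
have rr i : r i \in rs by rewrite mem_nth.
exists (size rs), r; split.
- by have := rep_rs 1 (integer_units1 F); case: (rs).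
- by move=> i; have [] := rsP _ (rr i).
- move=> u uu.
  have ru i : integer_units (r i * u) by apply: integer_unitsM => //; have [] := rsP _ (rr i).
  have idx i : (index (rep (r i * u)%R) rs < size rs)%N by rewrite index_mem rep_rs.
  pose f i := Ordinal (idx i).
  have rf i : r (f i) = rep (r i * u) by rewrite /r nth_index// rep_rs.
  exists f => [i j /(congr1 r)|i]; last first.
    rewrite rf -opprB; apply: ideal_powN.
    by have [] := repP _ (integer_units_int (ru i)).
  rewrite !rf => e; have eij : r i = r j.
    have [_ <-] := rsP _ (rr i); have [_ <-] := rsP _ (rr j).
    apply: rep_eq; have : ideal_pow M (r i * u - r j * u).
      have [_ Hi] := repP _ (integer_units_int (ru i)).
      have [_ Hj] := repP _ (integer_units_int (ru j)).
      rewrite -(subrK (rep (r i * u)) (r i * u)) {2}e -addrA.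
      by apply: ideal_powD => //; rewrite -opprB; apply: ideal_powN.
    rewrite -mulrBl => /(ideal_powMl varpi_unif (integer_units_int (integer_unitsV uu))).
    by rewrite mulrC mulfK// integer_units_neq0.
  apply/val_inj/eqP; rewrite -(nth_uniq 0 (ltn_ord i) (ltn_ord j) (undup_uniq _)).
  exact/eqP.
Qed.

End ResidueField.

(** * The Laurent polynomial ring *)

Section LaurentRing.
Variable k : fieldType.
Local Notation A := (laurent k).
Local Notation X1 := (laurent_X1 k).
Local Notation X2 := (laurent_X2 k).

Fact laurentC_zmod_morphism : zmod_morphism (@laurentC k).
Proof. by move=> a b; apply: val_inj; rewrite /= !polyCB tofracB. Qed.
Fact laurentC_monoid_morphism : monoid_morphism (@laurentC k).
Proof.
split=> [|a b]; apply: val_inj; first by rewrite /= !polyC1 tofrac1.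
by rewrite /= !polyCM tofracM.
Qed.
HB.instance Definition _ :=
  GRing.isZmodMorphism.Build k A (@laurentC k) laurentC_zmod_morphism.
HB.instance Definition _ :=
  GRing.isMonoidMorphism.Build k A (@laurentC k) laurentC_monoid_morphism.

Definition laurent_of_poly (P : {poly {poly k}}) : A := MkLaurent (laurent_poly P).

Fact laurent_of_poly_zmod_morphism : zmod_morphism laurent_of_poly.
Proof. by move=> a b; apply: val_inj; rewrite /= tofracB. Qed.
Fact laurent_of_poly_monoid_morphism : monoid_morphism laurent_of_poly.
Proof.
by split=> [|a b]; apply: val_inj; rewrite /= ?tofrac1 ?tofracM.
Qed.
HB.instance Definition _ := GRing.isZmodMorphism.Build
  {poly {poly k}} A laurent_of_poly laurent_of_poly_zmod_morphism.
HB.instance Definition _ := GRing.isMonoidMorphism.Build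
  {poly {poly k}} A laurent_of_poly laurent_of_poly_monoid_morphism.

Lemma laurent_of_poly_inj : injective laurent_of_poly.
Proof. by move=> P Q [] /eqP; rewrite tofrac_eq => /eqP. Qed.

Lemma laurentCE c : laurentC c = laurent_of_poly c%:P%:P.
Proof. exact: val_inj. Qed.
Lemma laurent_X1E : X1 = laurent_of_poly 'X%:P.
Proof. exact: val_inj. Qed.
Lemma laurent_X2E : X2 = laurent_of_poly 'X.
Proof. exact: val_inj. Qed.

Lemma laurent_clear (x : A) : exists m n P,
  x * (X1 ^+ m * X2 ^+ n) = laurent_of_poly P.
Proof.
have /asboolP[m [n [P xE]]] := laurent_valP x.
exists m, n, P; apply: val_inj; rewrite !rmorphM !rmorphXn /= xE.
rewrite -/(ratfun_X1 k) -/(ratfun_X2 k) divfK//.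
by rewrite mulf_neq0 ?expf_neq0 ?ratfun_X1_neq0 ?ratfun_X2_neq0.
Qed.

Lemma laurent_X1_neq_X2 (a b : k) : b != 0 -> laurentC a * X1 != laurentC b * X2.
Proof.
move=> b0; apply/eqP; rewrite !laurentCE laurent_X1E laurent_X2E -!rmorphM.
move=> /laurent_of_poly_inj/(congr1 (fun P : {poly {poly k}} => P`_1)).
by rewrite coefC coefCM coefX mulr1 => /esym/eqP; rewrite polyC_eq0 (negbTE b0).
Qed.

(** X divides a product over a domain only if it divides a factor, so powers of X can be cancelled
    until the degrees leave only constants. *)
Lemma monomial_divisor (D : idomainType) (P Q : {poly D}) (c : D) n :
  c != 0 -> P * Q = c%:P * 'X^n -> exists e j, P = e%:P * 'X^j.
Proof.
move=> c0; elim: n P Q => [|n IH] P Q PQ.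
  have sPQ : size (P * Q) = 1%N by rewrite PQ mulr1 size_polyC c0.
  have P0 : P != 0 by apply/eqP => P0; move: sPQ; rewrite P0 mul0r size_poly0.
  have Q0 : Q != 0 by apply/eqP => Q0; move: sPQ; rewrite Q0 mulr0 size_poly0.
  move: sPQ; rewrite size_mul// => /eqP; rewrite -size_poly_gt0 in Q0.
  move: Q0; case: (size Q) => // s _; rewrite addnS /= => /eqP sP.
  have /size_poly1P[e _ ->] : size P == 1%N.
    by rewrite eqn_leq size_poly_gt0 P0 andbT -sP leq_addr.
  by exists e, 0%N; rewrite mulr1.
have X0 : 'X != 0 :> {poly D} by rewrite polyX_eq0.
have dvdX (S : {poly D}) : S`_0 = 0 -> exists S', S = S' * 'X.
  by move=> S0; have /factor_theorem[S' ->] : root S 0;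
    [rewrite /root horner_coef0 S0|exists S'; rewrite subr0].
have : (P * Q)`_0 = 0 by rewrite PQ exprSr mulrA coefMX.
rewrite coef0M => /eqP; rewrite mulf_eq0 => /orP[]/eqP/dvdX[S SE].
  have [|e [j SX]] := IH S Q; last by exists e, j.+1; rewrite SE SX exprSr mulrA.
  by apply: (mulIf X0); rewrite mulrAC -SE PQ exprSr mulrA.
apply: (IH P S); apply: (mulIf X0).
by rewrite -mulrA -SE PQ exprSr mulrA.
Qed.

Lemma laurent_monomial_unit m n : X1 ^+ m * X2 ^+ n \is a GRing.unit.
Proof. by rewrite unitrM !unitrX ?laurent_X1_unit ?laurent_X2_unit. Qed.

Lemma laurent_of_poly_X1 (a : k) n :
  laurent_of_poly ((1 - a%:P * 'X) * 'X^n)%:P = (1 - laurentC a * X1) * X1 ^+ n.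
Proof.
rewrite laurentCE laurent_X1E -(rmorph1 laurent_of_poly) -rmorphXn -rmorphM -rmorphB.
by rewrite -rmorphM; congr laurent_of_poly; rewrite polyCM polyCB polyCM rmorphXn.
Qed.

Lemma laurent_of_poly_X2 (b : k) :
  laurent_of_poly (1 - b%:P%:P * 'X) = 1 - laurentC b * X2.
Proof. by rewrite rmorphB rmorph1 rmorphM /= -laurentCE -laurent_X2E. Qed.

Lemma laurent_of_poly_monomial m n :
  laurent_of_poly (('X^m)%:P * 'X^n) = X1 ^+ m * X2 ^+ n.
Proof. by rewrite rmorphM !rmorphXn /= -laurent_X1E -laurent_X2E. Qed.

(* A divisor of [1 - a X1] is, up to units, a polynomial in X1 alone; dividing
   [1 - b X2] then forces it to divide the monomials in X1. *)
Lemma laurent_coprime (a b : k) (v x y : A) :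
  v * x = 1 - laurentC a * X1 -> v * y = 1 - laurentC b * X2 ->
  v \is a GRing.unit.
Proof.
have [i [j [P PE]]] := laurent_clear v; have [m [n [Q QE]]] := laurent_clear x.
have [m' [n' [Q' QE']]] := laurent_clear y => vx vy.
have PQ : P * Q = ((1 - a%:P * 'X) * 'X^(i + m))%:P * 'X^(j + n).
  apply: laurent_of_poly_inj; rewrite rmorphM [RHS]rmorphM /= -PE -QE mulrACA vx.
  rewrite laurent_of_poly_X1 rmorphXn /= -laurent_X2E !exprD.
  by rewrite -[RHS]mulrA; congr (_ * _); rewrite mulrACA.
have PQ' : P * Q' = (1 - b%:P%:P * 'X) * (('X^(i + m'))%:P * 'X^(j + n')).
  apply: laurent_of_poly_inj; rewrite rmorphM [RHS]rmorphM /= -PE -QE' mulrACA vy.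
  rewrite laurent_of_poly_X2 laurent_of_poly_monomial !exprD.
  by congr (_ * _); rewrite mulrACA.
have c0 : (1 - a%:P * 'X) * 'X^(i + m) != 0.
  rewrite mulf_neq0 ?(monic_neq0 (monicXn _ _))//; apply/eqP.
  move=> /(congr1 (fun P : {poly k} => P`_0)).
  by rewrite coefB coef1 coefMX coef0 subr0 => /eqP; rewrite oner_eq0.
have [e [l PM]] := monomial_divisor c0 PQ.
(* In degree [j + n'] of X2 the term with b does not contribute, which leaves a monomial in X1. *)
have : (P * Q')`_(j + n') = 'X^(i + m').
  rewrite PQ' mulrA coefMXn ltnn subnn mulrBl mul1r coefB coefC eqxx.
  by rewrite mulrC mulrA coefMX subr0.
rewrite PM -mulrA coefCM; set g := (_`__) => eg.
suff : v * (X1 ^+ i * X2 ^+ j * laurent_of_poly g%:P) \is a GRing.unit.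
  by rewrite unitrM => /andP[].
rewrite mulrA PE PM -rmorphM mulrAC -polyCM eg rmorphM !rmorphXn /=.
by rewrite -laurent_X1E -laurent_X2E laurent_monomial_unit.
Qed.

(** Evaluation at X1 = 1/a and X2 = 1/b kills both generators but not the monomial that clears
    denominators. *)
Lemma laurent_ideal_proper (a b : k) (x y : A) : a != 0 -> b != 0 ->
  (1 - laurentC a * X1) * x + (1 - laurentC b * X2) * y != 1.
Proof.
move=> a0 b0; apply/eqP => xy1.
have [m [n [P PE]]] := laurent_clear x; have [m' [n' [Q QE]]] := laurent_clear y.
have [S [SX SE]] : exists S : nat -> nat -> {poly {poly k}},
    (forall i j, laurent_of_poly (S i j) = X1 ^+ i * X2 ^+ j) /\
    forall i j, S i j = ('X^i)%:P * 'X^j.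
  by exists (fun i j => ('X^i)%:P * 'X^j); split=> // i j; exact: laurent_of_poly_monomial.
have : ((1 - a%:P * 'X) * 'X^0)%:P * P * S m' n' +
    (1 - b%:P%:P * 'X) * Q * S m n = S m n * S m' n'.
  apply: laurent_of_poly_inj; rewrite rmorphD [RHS]rmorphM.
  rewrite [X in X + _]rmorphM [X in _ + X]rmorphM.
  rewrite [X in X * _ + _]rmorphM [X in _ + X * _]rmorphM /= -PE -QE.
  rewrite laurent_of_poly_X1 laurent_of_poly_X2 !SX mulr1.
  move: xy1 (X1 ^+ m * _) (X1 ^+ m' * _).
  move: (1 - _ * X1) (1 - _ * X2) => U V xy1 M1 M2.
  rewrite -[RHS]mul1r -xy1 [RHS]mulrDl !mulrA; congr (_ + _).
  by rewrite -!mulrA [M1 * M2]mulrC.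
rewrite !SE => /(congr1 (fun P : {poly {poly k}} => P.[(b^-1)%:P].[a^-1])).
rewrite !(hornerM, hornerD, hornerN, hornerC, hornerX, hornerXn) /=.
rewrite !(hornerM, hornerD, hornerN, hornerC, hornerX, hornerXn, horner_exp).
rewrite !mulfV// subrr !mul0r addr0.
by move=> /esym/eqP; rewrite !mulf_eq0 !expf_eq0 !invr_eq0 (negbTE a0) (negbTE b0) !andbF.
Qed.

End LaurentRing.

(** * Coordinates on GL2 and the torus character *)

Section GL2Coordinates.
Variable F : fieldType.

Lemma mulmx22E (M N : 'M[F]_2) i j : (M *m N) i j = M i 0 * N 0 j + M i 1 * N 1 j.
Proof. by rewrite mxE big_ord_recl big_ord1; congr (_ + M i _ * N _ j); apply: val_inj. Qed.

Lemma ord2P (P : 'I_2 -> Prop) : P 0 -> P 1 -> forall i, P i.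
Proof.
move=> P0 P1 [[|[|//]] Hi].
  by rewrite (_ : Ordinal Hi = 0)//; apply: val_inj.
by rewrite (_ : Ordinal Hi = 1)//; apply: val_inj.
Qed.

Lemma det22 (M : 'M[F]_2) : \det M = M 0 0 * M 1 1 - M 0 1 * M 1 0.
Proof.
rewrite (expand_det_row _ 0) big_ord_recl big_ord1 /cofactor !det_mx11 !mxE /=.
rewrite expr0 expr1 mul1r mulN1r mulrN; congr (_ * M _ _ - M _ _ * M _ _); exact: val_inj.
Qed.

Definition mx22 (a b c d : F) : 'M[F]_2 :=
  \matrix_(i, j) if i == 0 then if j == 0 then a else b else if j == 0 then c else d.

Lemma mx22_unit a b c d : a * d - b * c != 0 -> mx22 a b c d \in unitmx.
Proof. by rewrite unitmxE det22 !mxE /= unitfE. Qed.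

Fact lower_subproof (x : F) : 1 * 1 - 0 * x != 0 :> F.
Proof. by rewrite mul0r subr0 mulr1 oner_neq0. Qed.
Fact weyl_subproof (y : F) : 0 * y - (-1) * 1 != 0 :> F.
Proof. by rewrite mul0r sub0r mulr1 opprK oner_neq0. Qed.
Fact weyl_inv_subproof (y : F) : y * 0 - 1 * (-1) != 0 :> F.
Proof. by rewrite mulr0 sub0r mul1r opprK oner_neq0. Qed.

(** [lower x] and [weyl y] represent the two affine charts of B\GL2, glued by y = 1/x; [weyl 0] is
    the point at infinity. *)
Definition lower x : GL2 F := MkGL2 (mx22_unit (lower_subproof x)).
Definition weyl y : GL2 F := MkGL2 (mx22_unit (weyl_subproof y)).
Definition weyl_inv y : GL2 F := MkGL2 (mx22_unit (weyl_inv_subproof y)).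

Lemma GL2P (g h : GL2 F) : (forall i j, g i j = h i j) -> g = h.
Proof. by move=> gh; apply/val_inj/matrixP. Qed.

Lemma GL2_mulE (g h : GL2 F) i j : (g * h)%g i j = g i 0 * h 0 j + g i 1 * h 1 j.
Proof. exact: mulmx22E. Qed.

Lemma GL2_1E i j : (1%g : GL2 F) i j = (i == j)%:R.
Proof. by rewrite /= mxE. Qed.

Lemma lowerK x : (lower (- x) * lower x)%g = 1%g.
Proof.
apply: GL2P; apply: ord2P; apply: ord2P; rewrite GL2_mulE GL2_1E !mxE /=.
all: by rewrite ?(mulr0, mul0r, mulr1, mul1r, addr0, add0r, addNr).
Qed.

Lemma weylK y : (weyl_inv y * weyl y)%g = 1%g.
Proof.
apply: GL2P; apply: ord2P; apply: ord2P; rewrite GL2_mulE GL2_1E !mxE /=.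
all: by rewrite ?(mulr0, mul0r, mulr1, mul1r, mulrN1, oppr0, opprK, addr0, add0r, addNr).
Qed.

(** The diagonal of the Borel factor is recorded because the inducing character sees nothing
    else. *)
Lemma GL2_lower_decomp (g : GL2 F) : g 1 1 != 0 -> exists b,
  [/\ borel b, b 0 0 = g 0 0 - g 0 1 * (g 1 0 / g 1 1), b 1 1 = g 1 1
    & g = (b * lower (g 1 0 / g 1 1)%R)%g].
Proof.
move=> d0; exists (g * lower (- (g 1 0 / g 1 1))%R)%g.
split; rewrite /borel /=.
- rewrite mulmx22E !mxE /=. rewrite mulr1 mulrN mulrCA. by rewrite divff// mulr1 subrr.
- by rewrite mulmx22E !mxE /= mulr1 mulrN.
- by rewrite mulmx22E !mxE /= mulr0 add0r mulr1.
- by rewrite -mulgA lowerK mulg1.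
Qed.

Lemma GL2_weyl_decomp (g : GL2 F) : g 1 0 != 0 -> exists b,
  [/\ borel b, b 0 0 = g 0 0 * (g 1 1 / g 1 0) - g 0 1, b 1 1 = g 1 0
    & g = (b * weyl (g 1 1 / g 1 0)%R)%g].
Proof.
move=> c0; exists (g * weyl_inv (g 1 1 / g 1 0)%R)%g.
split; rewrite /borel /=.
- by rewrite mulmx22E !mxE /= mulrN1 mulrCA divff// mulr1 subrr.
- by rewrite mulmx22E !mxE /= mulrN1.
- by rewrite mulmx22E !mxE /= mulr0 addr0 mulr1.
- by rewrite -mulgA weylK mulg1.
Qed.

Lemma GL2_det_neq0 (g : GL2 F) : g 0 0 * g 1 1 - g 0 1 * g 1 0 != 0.
Proof. by have := GL2_unit g; rewrite unitmxE det22 unitfE. Qed.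

Lemma GL1_embedE (a : F) (a0 : a != 0) i j :
  GL1_embed a0 i j = if i == j then if i == 0 then a else 1 else 0.
Proof.
move: i j; apply: ord2P; apply: ord2P; rewrite !mxE /= ?mulr0n ?mulr1n//.
Qed.

End GL2Coordinates.

(** * The inducing character on the diagonal torus *)

Section TorusCharacter.
Variables (R : realType) (p : nat) (p_pr : prime p).
Variables (F : fieldExtType (padic_field p_pr)) (varpi : F).
Variables (varpi_unif : uniformizer varpi).
Variables (q : nat) (q_gt1 : (1 < q)%N).
Local Notation A := (laurent R[i]).
Local Notation QA := {fraction A}.
Local Notation absval := (absval R varpi q).
Local Notation ideal_pow := (ideal_pow varpi).
Local Notation varpi0 := (uniformizer_neq0 varpi_unif).

Let qR_gt1 : (1 : R) < q%:R. Proof. by rewrite ltr1n. Qed.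
Let qR_neq0 : (q%:R : R) != 0.
Proof. by rewrite pnatr_eq0 -lt0n ltnW. Qed.
Let qR_gt0 : (0 : R) < q%:R. Proof. exact: lt_trans qR_gt1. Qed.

Lemma absval_lt_ideal (N : int) x : absval x < q%:R ^ (- N) -> ideal_pow N x.
Proof.
rewrite /absval; have [->|x0] := eqVneq x 0; first by move=> _; apply: ideal_pow_0.
by rewrite ltr_eXz2l// ltrN2 => /ltW Nx; apply/ideal_pow_ord.
Qed.

Lemma ideal_absval_lt (e : R) : 0 < e ->
  exists N : nat, forall x, ideal_pow N x -> absval x < e.
Proof.
(* N exceeds 1/e, and [q ^ N] exceeds N. *)
move=> e0; pose N := Num.Def.archi_bound e^-1; exists N => x xN.
rewrite /absval; have [//|x0] := eqVneq x 0.
have qN : q%:R ^ (- N%:Z) < e.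
  rewrite -invr_expz invf_plt ?posrE ?exprz_gt0//.
  apply: (lt_trans (archi_boundP _)); first by rewrite invr_ge0 ltW.
  by rewrite -/N -exprnP -natrX ltr_nat ltn_expl.
apply: le_lt_trans qN; rewrite ler_eXz2l// lerN2.
by apply/(ideal_pow_ord varpi_unif).
Qed.

(** Trades the real absolute value for congruences modulo powers of varpi, in which local constancy
    is handled from here on. *)
Lemma locally_constantP (T : Type) (f : GL2 F -> T) :
  locally_constant R varpi q f <->
  forall g : GL2 F, exists N : nat, forall h : GL2 F,
    (forall i j, ideal_pow N (h i j - g i j)) -> f h = f g.
Proof.
split=> fc g.
  have [e e0 fe] := fc g; have [N NP] := ideal_absval_lt e0.
  by exists N => h hg; apply: fe => i j; apply: NP.
have [N fN] := fc g; exists (q%:R ^ (- N%:Z)); first by rewrite exprz_gt0.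
by move=> h hg; apply: fN => i j; apply: absval_lt_ideal.
Qed.

(** The inducing character, [delta_B ^ (1/2)] times chi, at the diagonal matrix with entries s and
    t. *)
Definition torus_char (s t : F) : A :=
  laurentC (Num.sqrt (absval (s / t)))%:C%C *
    (laurent_X1 _ ^ ord varpi s * laurent_X2 _ ^ ord varpi t).

Lemma delta_chiE (b : GL2 F) : delta_chi R varpi q b = torus_char (b 0 0) (b 1 1).
Proof. by []. Qed.

Lemma absvalM x y : x != 0 -> y != 0 -> absval (x * y) = absval x * absval y.
Proof.
move=> x0 y0; rewrite /absval mulf_eq0 (negbTE x0) (negbTE y0) /=.
by rewrite ordM// opprD expfzDr.
Qed.

Lemma torus_charM s t s' t' : s != 0 -> t != 0 -> s' != 0 -> t' != 0 ->
  torus_char (s * s') (t * t') = torus_char s t * torus_char s' t'.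
Proof.
have perm (S : comNzRingType) (a b c d e f : S) :
    a * b * ((c * d) * (e * f)) = (a * (c * e)) * (b * (d * f)).
  by rewrite [RHS]mulrACA; congr (_ * _); rewrite [RHS]mulrACA.
move=> s0 t0 s0' t0'; rewrite /torus_char.
have -> : laurentC (Num.sqrt (absval (s * s' / (t * t'))))%:C%C =
    laurentC (Num.sqrt (absval (s / t)))%:C%C *
    laurentC (Num.sqrt (absval (s' / t')))%:C%C :> A.
  have -> : absval (s * s' / (t * t')) = absval (s / t) * absval (s' / t').
    by rewrite -mulf_div; apply: absvalM; rewrite mulf_neq0 ?invr_eq0.
  rewrite sqrtrM; last by rewrite /absval; case: ifP => // _; rewrite ltW// exprz_gt0.
  by rewrite -rmorphM; congr laurentC; rewrite rmorphM.
rewrite !ordM// (exprzDr (laurent_X1_unit _)) (exprzDr (laurent_X2_unit _)).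
exact: perm.
Qed.

Lemma torus_char_units s t : integer_units s -> integer_units t -> torus_char s t = 1.
Proof.
move=> us ut; rewrite /torus_char !ord_unit// !expr0z !mulr1.
have ust : integer_units (s / t) by apply: integer_unitsM => //; apply: integer_unitsV.
rewrite /absval (negbTE (integer_units_neq0 ust)) ord_unit// oppr0 expr0z sqrtr1.
by rewrite !rmorph1.
Qed.

Lemma torus_char_unit s t : s != 0 -> t != 0 -> torus_char s t \is a GRing.unit.
Proof.
move=> s0 t0; apply: (@cunitPl _ _ (torus_char s^-1 t^-1)).
rewrite -torus_charM ?invr_eq0// !mulVf//.
by rewrite torus_char_units//; exact: integer_units1.
Qed.

Lemma ord_uniformizer : ord varpi varpi = 1.
Proof. by rewrite -[X in ord _ X]expr1z ord_uniformizer_exp. Qed.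

(** This value is the parameter a, the square root coming from |varpi| = 1/q; [torus_char2] gives
    b. *)
Lemma torus_char1 : torus_char varpi 1 =
  laurentC (Num.sqrt (q%:R : R))%:C%C^-1 * laurent_X1 _.
Proof.
have sE : Num.sqrt (absval (varpi / 1)) = (Num.sqrt q%:R)^-1.
  rewrite divr1 /absval (negbTE varpi0) ord_uniformizer -invr_expz expr1z.
  by rewrite sqrtrV ?ltW.
rewrite /torus_char sE fmorphV ord_uniformizer (expr1z (laurent_X1 _)).
by rewrite ord_one// expr0z (mulr1 (laurent_X1 _)).
Qed.

Lemma torus_char2 : torus_char 1 varpi =
  laurentC (Num.sqrt (q%:R : R))%:C%C * laurent_X2 _.
Proof.
have sE : Num.sqrt (absval (1 / varpi)) = Num.sqrt q%:R.
  rewrite div1r /absval invr_eq0 (negbTE varpi0) ordV ?varpi0//.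
  by rewrite ord_uniformizer opprK expr1z.
rewrite /torus_char sE ord_uniformizer (expr1z (laurent_X2 _)).
by rewrite ord_one// expr0z (mul1r (laurent_X2 _)).
Qed.

End TorusCharacter.

(** * Invariant forms on the principal series *)

Section InvariantForms.
Variables (p : nat) (p_pr : prime p) (F : fieldExtType (padic_field p_pr)).
Variables (varpi : F) (varpi_unif : uniformizer varpi).
Variables (q : nat) (q_card : residue_field F #= `I_q).
Variables (K : fieldType) (d : F -> F -> K).
Local Notation ideal_pow := (ideal_pow varpi).
Local Notation ord := (ord varpi).
Local Notation varpi0 := (uniformizer_neq0 varpi_unif).

Hypothesis dM : forall s t s' t', s != 0 -> t != 0 -> s' != 0 -> t' != 0 ->
  d (s * s') (t * t') = d s t * d s' t'.
Hypothesis d_units : forall s t, integer_units s -> integer_units t -> d s t = 1.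

(** Sections are bare functions into a field K, and [d] is any multiplicative function on the torus
    trivial on units; this keeps the argument apart from the Laurent ring. *)
Definition principal_series : set (GL2 F -> K) := [set f |
  (forall g : GL2 F, exists N : nat, forall h : GL2 F,
     (forall i j, ideal_pow N (h i j - g i j)) -> f h = f g) /\
  forall b g, borel b -> f (b * g)%g = d (b 0 0) (b 1 1) * f g].
Local Notation series := principal_series.

Lemma char_neq0 s t : s != 0 -> t != 0 -> d s t != 0.
Proof.
move=> s0 t0; apply/eqP => d0; have := dM s0 t0 (_ : s^-1 != 0) (_ : t^-1 != 0).
rewrite d0 mul0r !divff// d_units ?invr_eq0; try exact: integer_units1.
by move=> /(_ s0 t0)/eqP; rewrite oner_eq0.
Qed.

Lemma char_inv s t : s != 0 -> t != 0 -> d s^-1 t^-1 = (d s t)^-1.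
Proof.
move=> s0 t0; apply: (mulfI (char_neq0 s0 t0)).
rewrite -dM ?invr_eq0// !divff// ?char_neq0// d_units//; exact: integer_units1.
Qed.

Lemma char_inv_l s : s != 0 -> d s^-1 1 = (d s 1)^-1.
Proof. by move=> s0; have := char_inv s0 (oner_neq0 F); rewrite invr1. Qed.

Lemma char_inv_r t : t != 0 -> d 1 t^-1 = (d 1 t)^-1.
Proof. by move=> t0; have := char_inv (oner_neq0 F) t0; rewrite invr1. Qed.

Lemma series_lin a f g : series f -> series g -> series (fun x => a * f x + g x).
Proof.
move=> [fl fB] [gl gB]; split=> [x|b x bB]; last first.
  by rewrite fB// gB// mulrDr mulrCA.
have [N NP] := fl x; have [M MP] := gl x; exists (maxn N M) => h hx.
rewrite NP ?MP// => i j; apply: ideal_pow_le (hx i j) => //;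
  by rewrite lez_nat leq_max leqnn ?orbT.
Qed.

Lemma series0 : series (fun=> 0).
Proof. by split=> [x|b x bB]; [exists 0%N|rewrite mulr0]. Qed.

Lemma series_scale a f : series f -> series (fun x => a * f x).
Proof.
move=> fS; have /= := series_lin a fS series0; congr series.
by apply/funext => x; rewrite addr0.
Qed.

Lemma series_sum n (c : 'I_n -> K) (f : 'I_n -> GL2 F -> K) :
  (forall i, series (f i)) -> series (fun x => \sum_(i < n) c i * f i x).
Proof.
elim: n c f => [|n IH] c f fS.
  by under eq_fun do rewrite big_ord0; exact: series0.
under eq_fun do rewrite big_ord_recl; apply: series_lin => //; exact: IH.
Qed.

Lemma series_translate (g0 : GL2 F) f : series f -> series (fun x => f (x * g0)%g).
Proof.
move=> [fl fB]; split=> [x|b x bB]; last by rewrite -mulgA; apply: fB.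
have [N NP] := fl (x * g0)%g.
(* The entries of g0 lie in [varpi ^ (- D) O], so multiplying by g0 loses at most D levels of
   precision. *)
have [D DP] : exists D : nat, forall i j, ideal_pow (- D%:Z) (g0 i j).
  have H y : exists D : nat, ideal_pow (- D%:Z) y.
    have [->|y0] := eqVneq y 0; first by exists 0%N; exact: ideal_pow_0.
    exists `|ord y|%N; apply/(ideal_pow_ord varpi_unif) => //.
    by rewrite lerNl abszE -normrN ler_norm.
  have /choice[D DP] (ij : 'I_2 * 'I_2) := H (g0 ij.1 ij.2).
  exists (\max_ij D ij) => i j; apply: ideal_pow_le (DP (i, j)) => //.
  by rewrite lerN2 lez_nat (leq_bigmax (i, j)).
exists (N + D)%N => h hx; apply: NP => i j; rewrite !GL2_mulE.
rewrite opprD addrACA -!mulrBl; apply: ideal_powD.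
  by have := ideal_powM varpi_unif (hx i 0) (DP 0 j); rewrite PoszD addrK.
by have := ideal_powM varpi_unif (hx i 1) (DP 1 j); rewrite PoszD addrK.
Qed.

Lemma series_lowerE f (g : GL2 F) : series f -> g 1 1 != 0 ->
  f g = d (g 0 0 - g 0 1 * (g 1 0 / g 1 1)) (g 1 1) * f (lower (g 1 0 / g 1 1)).
Proof.
move=> [_ fB] g0; have [b [bB b0 b1 {1}->]] := GL2_lower_decomp g0.
by rewrite fB// b0 b1.
Qed.

Lemma series_weylE f (g : GL2 F) : series f -> g 1 0 != 0 ->
  f g = d (g 0 0 * (g 1 1 / g 1 0) - g 0 1) (g 1 0) * f (weyl (g 1 1 / g 1 0)).
Proof.
move=> [_ fB] g0; have [b [bB b0 b1 {1}->]] := GL2_weyl_decomp g0.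
by rewrite fB// b0 b1.
Qed.

Lemma series_lower_weyl f x : series f -> x != 0 ->
  f (lower x) = d x^-1 x * f (weyl x^-1).
Proof.
move=> fS x0; rewrite series_weylE// !mxE /= ?subr0 ?mul1r//.
Qed.

Lemma series_ext f h : series f -> series h ->
  (forall x, f (lower x) = h (lower x)) -> f (weyl 0) = h (weyl 0) -> f = h.
Proof.
move=> fS hS lowE weyE; apply/funext => g.
have [d0|d0] := eqVneq (g 1 1) 0; last by rewrite !(series_lowerE _ d0)// lowE.
have c0 : g 1 0 != 0.
  by apply: contraNneq (GL2_det_neq0 g) => c0; rewrite d0 c0 !mulr0 subrr.
by rewrite !(series_weylE _ c0)// d0 mul0r weyE.
Qed.

(** The matrix diag(a, 1) moves to the left of [lower x] if x is replaced by x a, and the character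
    absorbs it. *)
Lemma translate_lower f (a : F) (a0 : a != 0) x : series f ->
  f (lower x * GL1_embed a0)%g = d a 1 * f (lower (x * a)).
Proof.
move=> fS; rewrite series_lowerE// !GL2_mulE !GL1_embedE !mxE /=.
  by rewrite ?(mul1r, mulr0, mul0r, addr0, add0r, subr0, mulr1, divr1).
by rewrite mulr0 add0r mulr1 oner_neq0.
Qed.

Lemma translate_weyl f (a : F) (a0 : a != 0) : series f ->
  f (weyl 0 * GL1_embed a0)%g = d 1 a * f (weyl 0).
Proof.
move=> fS; rewrite series_weylE// !GL2_mulE !GL1_embedE !mxE /=.
  by rewrite ?(mul1r, mulr0, mul0r, addr0, add0r, sub0r, mulr1, opprK).
by rewrite mul1r mul0r addr0.
Qed.

(** * Invariant forms and their values on the sections E_n *)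

Variable l : (GL2 F -> K) -> K.
Hypothesis l_lin : forall a f g, series f -> series g ->
  l (fun x => a * f x + g x) = a * l f + l g.
Hypothesis l_inv : forall a (a0 : a != 0) f, series f ->
  l (fun g => f (g * GL1_embed a0)%g) = l f.

Lemma form0 : l (fun=> 0) = 0.
Proof.
have /= := l_lin 1 series0 series0.
rewrite [X in l X = _](_ : _ = fun=> 0); last first.
  by apply/funext => x; rewrite mulr0 addr0.
by rewrite mul1r -[X in X = _ -> _]add0r => /addIr <-.
Qed.

Lemma form_scale a f : series f -> l (fun x => a * f x) = a * l f.
Proof.
move=> fS; have /= := l_lin a fS series0; rewrite form0 addr0 => <-; congr l.
by apply/funext => x; rewrite addr0.
Qed.

Lemma form_sum n (c : 'I_n -> K) (f : 'I_n -> GL2 F -> K) :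
  (forall i, series (f i)) ->
  l (fun x => \sum_(i < n) c i * f i x) = \sum_(i < n) c i * l (f i).
Proof.
elim: n c f => [|n IH] c f fS.
  by rewrite big_ord0; under eq_fun do rewrite big_ord0; exact: form0.
under eq_fun do rewrite big_ord_recl; rewrite big_ord_recl l_lin ?IH//.
exact: series_sum.
Qed.

Lemma not_ideal_inv n x : ~ ideal_pow n x -> x != 0 /\ ideal_pow (1 - n) x^-1.
Proof.
move=> nx; have x0 : x != 0.
  by apply/eqP => x0; apply: nx; rewrite x0; exact: ideal_pow_0.
split=> //; apply/(ideal_pow_ord varpi_unif); first by rewrite invr_eq0.
rewrite ordV// lerBlDr -lerBlDl opprK; move/(ideal_pow_ord varpi_unif _ x0): nx.
by move/negP; rewrite -ltNge addrC -lezD1 addrC.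
Qed.

Variable fsph : GL2 F -> K.
Hypothesis fsph_series : series fsph.
Hypothesis fsphK : forall k, GL2_integers k -> fsph k = 1.

Lemma spherical_lower x : integers F x -> fsph (lower x) = 1.
Proof.
move=> xO; apply: fsphK; split; last first.
  by rewrite det22 !mxE /= mulr1 mul0r subr0; exact: integer_units1.
by apply: ord2P; apply: ord2P; rewrite !mxE //=; do ?[exact: integers1|exact: integers0].
Qed.

Lemma spherical_weyl y : integers F y -> fsph (weyl y) = 1.
Proof.
move=> yO; apply: fsphK; split; last first.
  by rewrite det22 !mxE /= mul0r sub0r mulr1 opprK; exact: integer_units1.
apply: ord2P; apply: ord2P; rewrite !mxE //=;
  do ?[exact: integers1|exact: integers0|exact/integersN/integers1].
Qed.

(** Here 1/x is integral, so the chart at infinity applies, where fsph is 1. *)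
Lemma spherical_lower_far x : ~ ideal_pow 1 x -> fsph (lower x) = d x^-1 x.
Proof.
move=> /not_ideal_inv[x0]; rewrite subrr => /(ideal_pow0P varpi) xO.
by rewrite series_lower_weyl// spherical_weyl// mulr1.
Qed.

Local Notation alpha := (d varpi 1).
Local Notation beta := (d 1 varpi).
Hypothesis alpha_neq_beta : alpha != beta.

Let alpha0 : alpha != 0. Proof. by rewrite char_neq0 ?varpi0 ?oner_neq0. Qed.
Let beta0 : beta != 0. Proof. by rewrite char_neq0 ?varpi0 ?oner_neq0. Qed.
Let varpiV0 : varpi^-1 != 0. Proof. by rewrite invr_eq0 varpi0. Qed.

Lemma char_exp (n : int) : d (varpi ^ n) 1 = alpha ^ n.
Proof.
have H (m : nat) : d (varpi ^+ m) 1 = alpha ^+ m.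
  elim: m => [|m IH]; first by rewrite d_units//; exact: integer_units1.
  by rewrite !exprS -IH -dM ?mulr1 ?expf_neq0 ?varpi0 ?oner_neq0.
case: n => [m|m]; first exact: H.
by rewrite NegzE -!invr_expz char_inv_l ?H// expf_neq0 ?varpi0.
Qed.

(* The combination of [fsph] and its translate that cancels off the maximal
   ideal: the section supported on the maximal ideal in the coordinate [lower]. *)
Definition small_section (x : GL2 F) : K :=
  (1 - beta / alpha)^-1 * (- beta * fsph (x * GL1_embed varpiV0)%g + fsph x).

Let ratio_neq0 : 1 - beta / alpha != 0.
Proof.
rewrite subr_eq0 eq_sym; apply: contra alpha_neq_beta => /eqP e.
by rewrite -[beta](divfK alpha0) e mul1r.
Qed.

Lemma small_section_series : series small_section.
Proof. by apply/series_scale/series_lin => //; apply: series_translate. Qed.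

Lemma small_section_lower x : small_section (lower x) = (`[< ideal_pow 1 x >])%:R.
Proof.
rewrite /small_section translate_lower//.
have [x1|nx1] := pselect (ideal_pow 1 x).
  (* On the maximal ideal x / varpi is still integral, so both terms are constant; the prefactor
     normalizes their sum to 1. *)
  rewrite (asboolT x1) spherical_lower; last first.
    by have := x1; rewrite /ideal_pow /= expr1z.
  rewrite spherical_lower; last by apply/(ideal_pow0P varpi)/(ideal_pow_le varpi_unif _ x1).
  rewrite char_inv_l ?varpi0// mulr1 mulNr [_ + 1]addrC.
  by rewrite (mulVf ratio_neq0).
rewrite (asboolF nx1) (spherical_lower_far nx1).
have [x0 _] := not_ideal_inv nx1.
rewrite spherical_lower_far; last first.
  move=> xv; apply: nx1; have := ideal_powMl varpi_unif (uniformizer_int varpi_unif) xv.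
  by rewrite mulrC divfK ?varpi0.
have xv0 : x / varpi != 0 by rewrite mulf_neq0.
(* Off the maximal ideal the factor beta makes the translate agree with fsph. *)
have e : beta * (d varpi^-1 1 * d (x / varpi)^-1 (x / varpi)) = d x^-1 x.
  rewrite -!dM ?mulf_neq0 ?invr_eq0 ?varpi0 ?oner_neq0//.
  by rewrite !mul1r -invfM [varpi * _]mulrC divfK ?varpi0.
by rewrite mulNr e addNr mulr0.
Qed.

Lemma small_section_weyl : small_section (weyl 0) = 0.
Proof.
rewrite /small_section translate_weyl// spherical_weyl; last exact: integers0.
rewrite char_inv_r ?varpi0//.
by rewrite mulr1 mulNr divff// addNr mulr0.
Qed.

Hypothesis l_fsph : l fsph = 1 - alpha / beta.

(** The translate has the same value as fsph, so the value is (1 - beta)(1 - alpha / beta) divided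
    by 1 - beta / alpha. *)
Lemma form_small_section : l small_section = alpha * (1 - beta^-1).
Proof.
rewrite /small_section form_scale; last first.
  by apply: series_lin => //; apply: series_translate.
rewrite l_lin//; last exact: series_translate.
rewrite l_inv// l_fsph; apply: (mulfI ratio_neq0); rewrite mulVKf//.
by field; rewrite alpha0 beta0.
Qed.

Let varpiX_neq0 (n : int) : varpi ^ n != 0.
Proof. exact: uniformizer_exp_neq0. Qed.

(** This is E_n: translation rescales the support from the maximal ideal to [varpi ^ n O], and
    [alpha ^ (n - 1)] undoes the character value it introduces. *)
Definition ideal_section (n : int) (x : GL2 F) : K :=
  alpha ^ (n - 1) * small_section (x * GL1_embed (varpiX_neq0 (1 - n)))%g.

Lemma ideal_section_series n : series (ideal_section n).
Proof. exact/series_scale/series_translate/small_section_series. Qed.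

Lemma ideal_section_lower n x :
  ideal_section n (lower x) = (`[< ideal_pow n x >])%:R.
Proof.
rewrite /ideal_section translate_lower; last exact: small_section_series.
rewrite small_section_lower char_exp mulrA -expfzDr// addrA subrK subrr expr0z mul1r.
congr (nat_of_bool _)%:R; apply: asbool_equiv_eq.
have -> : ideal_pow 1 (x * varpi ^ (1 - n)) = ideal_pow n x.
  rewrite /ideal_pow /= -mulrA expfzDr ?varpi0// [varpi ^ 1 * _]mulrC mulfK.
    by rewrite invr_expz.
  exact: varpiX_neq0.
by [].
Qed.

Lemma ideal_section_weyl n : ideal_section n (weyl 0) = 0.
Proof.
rewrite /ideal_section translate_weyl ?small_section_weyl ?mulr0//.
exact: small_section_series.
Qed.

Lemma form_ideal_section n : l (ideal_section n) = alpha ^ n * (1 - beta^-1).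
Proof.
rewrite /ideal_section form_scale; last exact/series_translate/small_section_series.
rewrite l_inv ?form_small_section; last exact: small_section_series.
by rewrite mulrA -{2}[alpha]expr1z -expfzDr// subrK.
Qed.

Lemma ideal_section_ord n x : x != 0 ->
  ideal_section n (lower x) = (n <= ord x)%R%:R.
Proof.
move=> x0; rewrite ideal_section_lower; congr (nat_of_bool _)%:R.
apply/asboolP/idP => /(ideal_pow_ord varpi_unif n x0) //.
Qed.

Lemma lower_locally_constant f x : series f -> exists N : nat,
  forall y, ideal_pow N (y - x) -> f (lower y) = f (lower x).
Proof.
move=> [fl _]; have [N NP] := fl (lower x); exists N => y yx; apply: NP.
by apply: ord2P; apply: ord2P; rewrite !mxE //= subrr; exact: ideal_pow_0.
Qed.

Lemma weyl_locally_constant f x : series f -> exists N : nat,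
  forall y, ideal_pow N (y - x) -> f (weyl y) = f (weyl x).
Proof.
move=> [fl _]; have [N NP] := fl (weyl x); exists N => y yx; apply: NP.
by apply: ord2P; apply: ord2P; rewrite !mxE //= subrr; exact: ideal_pow_0.
Qed.

(** The integral points of the two charts are copies of the compact O and cover everything. A unit u
    sends x to x u in the first and 1/x to 1/(x u) in the second, so for u close to 1 it moves
    points of either by little. *)
Lemma series_unit_invariant f : series f -> exists2 M : nat, (0 < M)%N &
  forall u, integer_units u -> ideal_pow M (u - 1) ->
  forall x, f (lower (x * u)) = f (lower x).
Proof.
move=> fS.
have [M1 MP1] := uniformly_locally_constant varpi_unif q_card
  (fun x _ => lower_locally_constant x fS).
have [M2 MP2] := uniformly_locally_constant varpi_unif q_card
  (fun x _ => weyl_locally_constant x fS).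
(* The successor ensures 0 < M, so that congruence modulo [varpi ^ M] preserves units. *)
exists (maxn M1 M2).+1 => // u uu u1 x.
have uO := integer_units_int uu; have u0 := integer_units_neq0 uu.
have [xO|nxO] := pselect (integers F x).
  apply: MP1; rewrite ?integersM//; first exact: integersM.
  rewrite -{2}[x]mulr1 -mulrBr; apply: ideal_powMl => //.
  by apply: ideal_pow_le u1 => //; rewrite lez_nat leqW// leq_maxl.
have [x0 xV] : x != 0 /\ ideal_pow (1 - 0) x^-1.
  by apply: not_ideal_inv => /(ideal_pow0P varpi).
have xVO : integers F x^-1 by apply/(ideal_pow0P varpi)/(ideal_pow_le varpi_unif _ xV).
rewrite !series_lower_weyl ?mulf_neq0// invfM dM ?mulf_neq0 ?invr_eq0//.
rewrite (d_units (integer_unitsV uu) uu) mulr1; congr (_ * _).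
have uVO : integers F u^-1 by case: uu.
apply: MP2 => //; first exact: integersM.
rewrite -{2}[x^-1]mulr1 -mulrBr; apply: ideal_powMl => //.
have -> : u^-1 - 1 = - u^-1 * (u - 1) by rewrite mulNr mulrBr mulVf// mulr1 opprB.
apply: ideal_powMl => //; first exact: integersN.
by apply: ideal_pow_le u1 => //; rewrite lez_nat leqW// leq_maxr.
Qed.

(** * Sections with values in a subring S *)

Variable S : set K.
Hypothesis S1 : S 1.
Hypothesis SB : forall a b, S a -> S b -> S (a - b).
Hypothesis SM : forall a b, S a -> S b -> S (a * b).
Hypothesis Sd : forall s t, s != 0 -> t != 0 -> S (d s t).
Hypothesis K_natf : forall m, (0 < m)%N -> (m%:R : K) != 0.
Hypothesis Snat_inv : forall m, (0 < m)%N -> S m%:R^-1.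

Let S0 : S 0. Proof. by rewrite -(subrr 1); apply: SB. Qed.
Let SD a b : S a -> S b -> S (a + b).
Proof. by move=> aS bS; rewrite -[b]opprK -[- b]sub0r; do 2![apply: SB => //]. Qed.
Let Ssum n (f : 'I_n -> K) : (forall i, S (f i)) -> S (\sum_(i < n) f i).
Proof. by move=> fS; apply: big_ind. Qed.

(** Each translate by a unit has the same value under l, so averaging over units modulo
    [1 + varpi ^ M O] keeps l while making the section invariant under all units. *)
Lemma form_average f : series f -> exists h,
  [/\ series h, h (weyl 0) = f (weyl 0), l h = l f,
      forall u, integer_units u -> forall x, h (lower (x * u)) = h (lower x)
    & (forall g, S (f g)) -> forall g, S (h g)].
Proof.
move=> fS; have [M M0 MP] := series_unit_invariant fS.
have [m [r [m0 rU rP]]] := unit_class_representatives varpi_unif q_card M0.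
have r0 i : r i != 0 by apply: integer_units_neq0.
pose t i (x : GL2 F) := f (x * GL1_embed (r0 i))%g.
have tS i : series (t i) by exact: series_translate.
have const (c : K) : \sum_(i < m) m%:R^-1 * c = c.
  by rewrite sumr_const card_ord -[LHS]mulr_natl mulVKf// K_natf.
pose h x := \sum_(i < m) m%:R^-1 * t i x.
have hlow x : h (lower x) = \sum_(i < m) m%:R^-1 * f (lower (x * r i)).
  apply: eq_bigr => i _; rewrite /t translate_lower// d_units ?mul1r//.
  exact: integer_units1.
exists h; split.
- exact: series_sum.
- rewrite -[RHS]const; apply: eq_bigr => i _; rewrite /t translate_weyl//.
  by rewrite d_units ?mul1r//; exact: integer_units1.
- rewrite /h form_sum// -[RHS]const; apply: eq_bigr => i _.
  by rewrite /t l_inv.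
- move=> u uu x; rewrite !hlow; have [s sinj sP] := rP u uu.
  rewrite [RHS](reindex_inj sinj); apply: eq_bigr => i _; congr (_ * _).
  (* [v] is the discrepancy between the product and its representative; it is 1 modulo [varpi ^ M],
     so f does not see it. *)
  have rsi := r0 (s i); pose v := r i * u / r (s i).
  have vU : integer_units v.
    by apply: integer_unitsM; [exact: integer_unitsM|exact: integer_unitsV].
  have -> : x * u * r i = x * r (s i) * v.
    by rewrite /v; field.
  apply: MP => //; have -> : v - 1 = - (r (s i))^-1 * (r (s i) - r i * u).
    by rewrite /v; field.
  by apply: ideal_powMl => //; apply: integersN; case: (rU (s i)).
- by move=> fS' g; apply: Ssum => i; apply: SM; [exact: Snat_inv|exact: fS'].
Qed.

(** Every g is a Borel element times some [lower x] or [weyl 0], and the character takes values in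
    S. *)
Lemma series_valued f : series f -> (forall x, S (f (lower x))) ->
  S (f (weyl 0)) -> forall g, S (f g).
Proof.
move=> fS lowS weyS g; have det0 := GL2_det_neq0 g.
have [d0|d0] := eqVneq (g 1 1) 0.
  have c0 : g 1 0 != 0.
    by apply: contraNneq det0 => c0; rewrite d0 c0 !mulr0 subrr.
  rewrite (series_weylE _ c0)// d0 mul0r; apply: SM => //; apply: Sd => //.
  rewrite mulr0 sub0r oppr_eq0; apply: contraNneq det0 => b0.
  by rewrite b0 d0 mulr0 mul0r subrr.
rewrite (series_lowerE _ d0)//; apply: SM => //; apply: Sd => //.
apply: contraNneq det0 => e; apply/eqP.
have -> : g 0 0 * g 1 1 - g 0 1 * g 1 0 =
    (g 0 0 - g 0 1 * (g 1 0 / g 1 1)) * g 1 1 by field.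
by rewrite e mul0r.
Qed.

Lemma spherical_valued g : S (fsph g).
Proof.
apply: series_valued => // [x|]; last by rewrite spherical_weyl//; exact: integers0.
have [x1|nx1] := pselect (ideal_pow 1 x).
  rewrite spherical_lower//.
  by apply/(ideal_pow0P varpi)/(ideal_pow_le varpi_unif _ x1).
have [x0 _] := not_ideal_inv nx1.
by rewrite spherical_lower_far//; apply: Sd => //; rewrite invr_eq0.
Qed.

Lemma ideal_section_valued n g : S (ideal_section n g).
Proof.
apply: series_valued => [|x|]; first exact: ideal_section_series.
  by rewrite ideal_section_lower; case: asbool.
by rewrite ideal_section_weyl.
Qed.

Lemma char_exp_valued (n : int) : S (alpha ^ n).
Proof. by rewrite -char_exp; apply: Sd; rewrite ?oner_neq0. Qed.

(** In the coordinate x such a g depends only on [ord x], is constant near 0 and zero near infinity,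
    so it is a finite combination of indicators of shells plus a multiple of one E_N. *)
Lemma form_invariant_decomp g : series g -> (forall x, S (g x)) -> g (weyl 0) = 0 ->
  (forall u, integer_units u -> forall x, g (lower (x * u)) = g (lower x)) ->
  exists2 a, S a & l g = a * (1 - beta^-1).
Proof.
move=> gS gSv gw ginv.
have [N1 NP1] := weyl_locally_constant 0 gS.
have [N2 NP2] := lower_locally_constant 0 gS.
(* The orders -N, ..., N - 1, between the neighbourhoods of infinity and of 0, are numbered from 0
   through [k]. *)
pose N := maxn N1 N2; pose k (i : nat) : int := i%:Z - N%:Z.
pose c (i : 'I_(N + N)) := g (lower (varpi ^ k i)).
(* The difference of E_n and E_(n+1) is the indicator of the shell of order n. *)
pose f (i : 'I_(N + N)) x := -1 * ideal_section (k i + 1) x + ideal_section (k i) x.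
have fS i : series (f i) by apply: series_lin; exact: ideal_section_series.
have gE : g = fun x => g (lower 0) * ideal_section N x + \sum_(i < N + N) c i * f i x.
  apply: series_ext => //.
  - by apply: series_lin; [exact: ideal_section_series|exact: series_sum].
  - move=> x; have [xN|nxN] := pselect (ideal_pow N x).
      rewrite ideal_section_lower asboolT// mulr1 big1 ?addr0 => [|i _].
        apply: NP2; rewrite subr0; apply: ideal_pow_le xN => //.
        by rewrite lez_nat leq_maxr.
      rewrite /f !ideal_section_lower !asboolT ?mulr1 ?addNr ?mulr0//.
        by apply: ideal_pow_le xN => //; have := ltn_ord i; rewrite /k; lia.
      by apply: ideal_pow_le xN => //; have := ltn_ord i; rewrite /k; lia.
    have [x0 _] := not_ideal_inv nxN.
    have nN : ord x < N.
      by rewrite ltNge; apply/negP => /(ideal_pow_ord varpi_unif _ x0).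
    rewrite ideal_section_ord// leNgt nN mulr0 add0r.
    have [nn|nn] := leP (- N%:Z) (ord x); last first.
      rewrite big1 => [|i _]; last first.
        rewrite /f !ideal_section_ord// !leNgt.
        have -> : ord x < k i + 1 by rewrite /k; lia.
        have -> : ord x < k i by rewrite /k; lia.
        by rewrite mulr0 addr0 mulr0.
      (* Below order -N, 1/x is so small that g takes its value at infinity, which is 0. *)
      rewrite series_lower_weyl// NP1 ?gw ?mulr0// subr0.
      apply/(ideal_pow_ord varpi_unif); rewrite ?invr_eq0// ordV//.
      by have := leq_maxl N1 N2; rewrite -/N; lia.
    have iN : (`|(ord x + N%:Z)%R| < N + N)%N by lia.
    rewrite (bigD1 (Ordinal iN))//= big1 ?addr0 => [|i /eqP ine].
      have kE : k `|(ord x + N%:Z)%R|%N = ord x by rewrite /k; lia.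
      rewrite /f /c /= kE !ideal_section_ord// lexx.
      have -> : (ord x + 1 <= ord x) = false by lia.
      rewrite mulr0 add0r mulr1.
      have [n [u [uu xE]]] := unit_factor varpi_unif x0.
      by rewrite {1}xE ginv// xE ordE.
    have kne : k i <> ord x.
      move=> e; apply: ine; apply: val_inj => /=; rewrite -e /k; lia.
    rewrite /f !ideal_section_ord//.
    have -> : (k i + 1 <= ord x) = (k i <= ord x) by lia.
    by case: (_ <= _); rewrite ?mulr0 ?mulr1 ?addNr ?addr0 mulr0.
  - by rewrite gw ideal_section_weyl big1 ?mulr0 ?addr0// => i _;
      rewrite /f !ideal_section_weyl !mulr0 addr0 ?mulr0.
exists (g (lower 0) * alpha ^ N + \sum_(i < N + N) c i * (alpha ^ k i - alpha ^ (k i + 1))).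
  apply: SD; first by apply: SM => //; exact: char_exp_valued.
  by apply: Ssum => i; apply: SM; [exact: gSv|apply: SB; exact: char_exp_valued].
rewrite {1}gE l_lin ?form_sum//; last 2 first.
- exact: ideal_section_series.
- exact: series_sum.
rewrite form_ideal_section mulrDl mulrA; congr (_ + _).
rewrite mulr_suml; apply: eq_bigr => i _; rewrite -mulrA; congr (_ * _).
rewrite /f l_lin; try exact: ideal_section_series.
by rewrite !form_ideal_section mulN1r addrC -mulrBl.
Qed.

(** After averaging, subtracting h(w) fsph makes the section vanish at infinity and keeps it
    invariant under units; the subtracted part contributes the multiple of l(fsph). *)
Lemma form_integral f : series f -> (forall g, S (f g)) ->
  exists a b, [/\ S a, S b & l f = a * (1 - alpha / beta) + b * (1 - beta^-1)].
Proof.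
move=> fS fSv; have [h [hS hw <- hinv hSv]] := form_average fS.
have {}hSv := hSv fSv.
pose g x := - h (weyl 0) * fsph x + h x.
have gS : series g by apply: series_lin.
have fsph_inv u : integer_units u -> forall x, fsph (lower (x * u)) = fsph (lower x).
  move=> uu x; have uO := integer_units_int uu; have u0 := integer_units_neq0 uu.
  have [x1|nx1] := pselect (ideal_pow 1 x).
    have xO : integers F x by apply/(ideal_pow0P varpi)/(ideal_pow_le varpi_unif _ x1).
    by rewrite !spherical_lower//; exact: integersM.
  have [x0 _] := not_ideal_inv nx1.
  rewrite !spherical_lower_far//.
    by rewrite invfM dM ?invr_eq0// (d_units (integer_unitsV uu) uu) mulr1.
  move=> xu; apply: nx1; rewrite -[x](mulfK u0) mulrC; apply: ideal_powMl => //.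
  by case: uu.
have gSv x : S (g x).
  apply: SD => //; apply: SM; last exact: spherical_valued.
  by rewrite -[- _]sub0r; apply: SB.
have [||b bS bE] := form_invariant_decomp gS gSv.
- by rewrite /g spherical_weyl ?mulr1 ?addNr//; exact: integers0.
- by move=> u uu x; rewrite /g fsph_inv// hinv.
exists (h (weyl 0)), b; split=> //; rewrite -bE /g l_lin// l_fsph.
by rewrite mulNr addNKr.
Qed.

End InvariantForms.

(** * The image of the integral sections *)

Section TwoGenerators.
Variables (D : idomainType) (a b : D).
Hypothesis b_unit : b \is a GRing.unit.
Local Notation u := (1 - a * b^-1).

(** 1 - a and 1 - b differ by b u, a multiple of u. *)
Lemma ideal2_exchange : ideal2 (1 - a) u = ideal2 (1 - b) u.
Proof.
have e : b * u = b - a by rewrite mulrBr mulr1 mulrCA divrr ?mulr1.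
apply/seteqP; split=> z [x [y ->]].
  by exists x, (b * x + y); rewrite mulrDr [u * (b * x)]mulrA [u * b]mulrC e; ring.
by exists x, (y - b * x); rewrite mulrBr [u * (b * x)]mulrA [u * b]mulrC e; ring.
Qed.

(** 1 - b^-1 is -b^-1 times 1 - b. *)
Lemma ideal2_inv z : (exists x y, z = x * u + y * (1 - b^-1)) -> ideal2 (1 - b) u z.
Proof.
move=> [x [y ->]]; exists (- (b^-1 * y)), x.
rewrite addrC [x * u]mulrC; congr (_ + _).
have e : 1 - b^-1 = - ((1 - b) * b^-1) by rewrite mulrBl mul1r divrr// opprB.
by rewrite e; move: b^-1 => w; ring.
Qed.

Hypothesis coprime : forall v x y : D,
  v * x = 1 - a -> v * y = 1 - b -> v \is a GRing.unit.
Hypothesis proper : forall x y : D, (1 - a) * x + (1 - b) * y != 1.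

(** u is b^-1 (1 - a) - b^-1 (1 - b), so the ideal lies in (1 - a, 1 - b), which is proper. *)
Lemma ideal2_not_1 : ~ ideal2 (1 - a) u 1.
Proof.
move=> [x [y e]]; have /eqP[] := proper (x + b^-1 * y) (- (b^-1 * y)).
rewrite [RHS]e; have -> : u = b^-1 * (1 - a) - b^-1 * (1 - b).
  have : b^-1 * b = 1 by rewrite mulVr.
  by move: b^-1 => w wb; rewrite !mulrBr mulr1 wb; ring.
by move: b^-1 => w; ring.
Qed.

Lemma ideal2_gen_l : ideal2 (1 - a) u (1 - a).
Proof. by exists 1, 0; rewrite mulr1 mulr0 addr0. Qed.

Lemma ideal2_gen_r : ideal2 (1 - a) u (1 - b).
Proof. by rewrite ideal2_exchange; exists 1, 0; rewrite mulr1 mulr0 addr0. Qed.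

(** Distinct basis elements v, w would satisfy the relation w v - v w = 0, so a basis has at most
    one element. That element would divide 1 - a and 1 - b, hence be a unit, and the ideal would
    contain 1. *)
Lemma ideal2_not_free : ~ free_submodule (ideal2 (1 - a) u : set D^o).
Proof.
move=> [B [BM Bgen Bfree]].
have Buniq v w : B v -> B w -> v = w.
  move=> Bv Bw; apply/eqP; apply: contrapT => /negP vw.
  pose c (x : D^o) : D := if x == v then w else - v.
  have inB x : x \in [:: v; w] -> B x by rewrite !inE => /orP[]/eqP ->.
  have us : uniq [:: v; w] by rewrite /= inE vw.
  have := Bfree [:: v; w] c us inB.
  rewrite !big_cons big_nil addr0 /c eqxx [w == v]eq_sym (negbTE vw).
  have -> : w *: v + - v *: w = 0 :> D^o by rewrite /GRing.scale /= mulNr mulrC subrr.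
  move=> /(_ erefl) z0.
  have w0 : w = 0 by have := z0 v; rewrite eqxx; apply; rewrite inE eqxx.
  have v0 : v = 0.
    apply/eqP; rewrite -oppr_eq0; apply/eqP; have := z0 w.
    by rewrite eq_sym (negbTE vw); apply; rewrite !inE eqxx orbT.
  by case/eqP: vw; rewrite v0 w0.
have [v [vB vgen]] : exists v : D, (v = 0 \/ B v) /\
    forall z, ideal2 (1 - a) u z -> exists x, v * x = z.
  have [[v Bv]|nB] := pselect (exists v, B v); last first.
    (* An empty basis leaves the zero ideal, with generator 0; this case is refuted at the end, as 0
       is not a unit. *)
    exists 0; split; first by left.
    move=> z /Bgen[s sB [c ->]]; exists 0; rewrite mul0r big_seq big1// => w /sB Bw.
    by case: nB; exists w.
  exists v; split; first by right.
  move=> z /Bgen[s sB [c ->]]; exists (\sum_(w <- s) c w).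
  rewrite mulr_sumr big_seq [RHS]big_seq; apply: eq_bigr => w /sB Bw.
  by rewrite (Buniq w v)// mulrC.
have [x xE] := vgen _ ideal2_gen_l; have [y yE] := vgen _ ideal2_gen_r.
have vU := coprime xE yE.
case: vB => [v0|/BM[x' [y' e]]]; first by rewrite v0 unitr0 in vU.
apply: ideal2_not_1; exists (x' * v^-1), (y' * v^-1).
by rewrite !mulrA -mulrDl -e divrr.
Qed.

End TwoGenerators.

(** * Specialization to coefficients in A and Q(A) *)

Section UnramifiedPrincipalSeries.
Variables (R : realType) (p : nat) (p_pr : prime p).
Variables (F : fieldExtType (padic_field p_pr)) (varpi : F) (q : nat).
Variables (varpi_unif : uniformizer varpi) (q_card : residue_field F #= `I_q).
Local Notation A := (laurent R[i]).
Local Notation QA := {fraction A}.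
Local Notation iQ := (iQ R varpi q).

Let q_gt1 : (1 < q)%N. Proof. exact: (residue_card_gt1 varpi_unif q_card). Qed.

Definition frac_char (s t : F) : QA := (torus_char R varpi q s t)%:F.

Lemma frac_charM s t s' t' : s != 0 -> t != 0 -> s' != 0 -> t' != 0 ->
  frac_char (s * s') (t * t') = frac_char s t * frac_char s' t'.
Proof. by move=> *; rewrite /frac_char torus_charM// tofracM. Qed.

Lemma frac_char_units s t :
  integer_units s -> integer_units t -> frac_char s t = 1.
Proof. by move=> *; rewrite /frac_char torus_char_units// tofrac1. Qed.

Lemma iQ_predP (f : GL2 F -> QA) :
  f \in iQ_pred varpi q <-> principal_series varpi frac_char f.
Proof.
have lcP := locally_constantP R varpi_unif q_gt1 f.
split=> [/asboolP[fl fB]|[fl fB]]; first by split; [exact/lcP|exact: fB].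
by apply/asboolP; split; [exact/lcP|exact: fB].
Qed.

Lemma iQ_linE (c : QA) (f g : iQ) : iQ_fun (c *: f + g) = fun x => c * f x + g x.
Proof. by []. Qed.

Variable l : {scalar iQ}.
Hypothesis l_inv : GL1_invariant l.

(** Extends l by 0 to all functions, since the abstract argument takes forms on bare functions. *)
Definition form_on_functions (f : GL2 F -> QA) : QA :=
  if pselect (f \in iQ_pred varpi q) is left fP then l (MkIQ fP) else 0.

Lemma form_on_functionsE (f : iQ) : form_on_functions f = l f.
Proof.
rewrite /form_on_functions; case: pselect => [fP|[]]; last exact: iQ_funP.
by congr (l _); apply: val_inj.
Qed.

Lemma form_on_functions_lin (c : QA) (f g : GL2 F -> QA) :
  principal_series varpi frac_char f -> principal_series varpi frac_char g ->
  form_on_functions (fun x => c * f x + g x) =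
    c * form_on_functions f + form_on_functions g.
Proof.
move=> /iQ_predP fP /iQ_predP gP.
have := form_on_functionsE (c *: MkIQ fP + MkIQ gP).
rewrite iQ_linE /= linearP => ->.
by rewrite -(form_on_functionsE (MkIQ fP)) -(form_on_functionsE (MkIQ gP)).
Qed.

Lemma form_on_functions_inv (c : F) (c0 : c != 0) (f : GL2 F -> QA) :
  principal_series varpi frac_char f ->
  form_on_functions (fun g => f (g * GL1_embed c0)%g) = form_on_functions f.
Proof.
move=> fS; have /iQ_predP gP := series_translate varpi_unif (GL1_embed c0) fS.
have /iQ_predP fP := fS.
rewrite -[LHS]/(form_on_functions (MkIQ gP)) -[RHS]/(form_on_functions (MkIQ fP)).
by rewrite !form_on_functionsE; apply: (l_inv (a0 := c0)).
Qed.

Variable fsph : iQ.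
Hypothesis fsphP : spherical fsph.

Lemma spherical_integers k : GL2_integers k -> fsph k = 1 :> QA.
Proof.
move=> kO; have B1 : borel (1%g : GL2 F) by rewrite /borel /= mxE.
have := fsphP B1 kO; rewrite mul1g delta_chiE !GL2_1E => ->.
by apply: frac_char_units; exact: integer_units1.
Qed.

Lemma fsph_principal_series : principal_series varpi frac_char fsph.
Proof. exact/iQ_predP/iQ_funP. Qed.

(** The copy of A inside Q(A), which plays the role of S. *)
Definition integral_fraction : set QA := [set x | exists c : A, x = c%:F].

Lemma integral_fraction1 : integral_fraction 1.
Proof. by exists 1; rewrite tofrac1. Qed.

Lemma integral_fractionB x y :
  integral_fraction x -> integral_fraction y -> integral_fraction (x - y).
Proof. by move=> [c ->] [c' ->]; exists (c - c'); rewrite tofracB. Qed.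

Lemma integral_fractionM x y :
  integral_fraction x -> integral_fraction y -> integral_fraction (x * y).
Proof. by move=> [c ->] [c' ->]; exists (c * c'); rewrite tofracM. Qed.

Lemma integral_fraction_char s t : s != 0 -> t != 0 ->
  integral_fraction (frac_char s t).
Proof. by move=> _ _; exists (torus_char R varpi q s t). Qed.

Lemma integral_fraction_nat m : (0 < m)%N ->
  (m%:R : QA) != 0 /\ integral_fraction m%:R^-1.
Proof.
move=> m0; pose c : A := laurentC (m%:R^-1 : R[i]).
have mc : m%:R * c%:F = 1 :> QA.
  rewrite -(rmorph_nat (@FracField.tofrac A)) -tofracM -(rmorph_nat (@laurentC _)).
  by rewrite -rmorphM mulfV ?rmorph1 ?tofrac1// pnatr_eq0 -lt0n.
have mN0 : (m%:R : QA) != 0.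
  by apply/eqP => mz; move/eqP: mc; rewrite mz mul0r eq_sym oner_eq0.
by split=> //; exists c; rewrite -[RHS](mulKf mN0) mc mulr1.
Qed.

Local Notation alpha := (torus_char R varpi q varpi 1).
Local Notation beta := (torus_char R varpi q 1 varpi).
Hypothesis alpha_neq_beta : alpha != beta.
Hypothesis l_fsph : l fsph = (1 - alpha * beta^-1)%:F.

Lemma beta_unit : beta \is a GRing.unit.
Proof. by rewrite torus_char_unit ?oner_neq0 ?uniformizer_neq0. Qed.

Lemma frac_beta_inv : (frac_char 1 varpi)^-1 = beta^-1%:F.
Proof. by rewrite /frac_char -(rmorphV (@FracField.tofrac A) beta_unit). Qed.

Lemma frac_alpha_neq_beta : frac_char varpi 1 != frac_char 1 varpi.
Proof. by rewrite /frac_char tofrac_eq. Qed.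

Lemma form_fsph : form_on_functions fsph = 1 - frac_char varpi 1 / frac_char 1 varpi.
Proof. by rewrite form_on_functionsE l_fsph tofracB tofracM tofrac1 frac_beta_inv. Qed.

Lemma form_iA f : iA R varpi q f ->
  exists x y : A, l f = (x * (1 - alpha * beta^-1) + y * (1 - beta^-1))%:F.
Proof.
move=> fA; rewrite -form_on_functionsE.
have [x [y [[x' ->] [y' ->] ->]]] := form_integral varpi_unif q_card frac_charM
  frac_char_units form_on_functions_lin form_on_functions_inv
  fsph_principal_series spherical_integers frac_alpha_neq_beta form_fsph
  integral_fraction1 integral_fractionB integral_fractionM integral_fraction_char
  (fun m m0 => (integral_fraction_nat m0).1) (fun m m0 => (integral_fraction_nat m0).2)
  ((iQ_predP f).1 (iQ_funP f)) fA.
have tofracE (D : idomainType) (s t c e : D) : (s * (1 - c * e) + t * (1 - e))%:F =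
    s%:F * (1 - c%:F * e%:F) + t%:F * (1 - e%:F) :> {fraction D}.
  by rewrite tofracD !tofracM !tofracB tofracM tofrac1.
by exists x', y'; rewrite frac_beta_inv tofracE.
Qed.

Lemma fsph_iA : iA R varpi q fsph.
Proof.
exact: (spherical_valued varpi_unif fsph_principal_series spherical_integers
  integral_fraction1 integral_fractionM integral_fraction_char).
Qed.

(** The section is E_0, for which the power of alpha in the value of l disappears. *)
Lemma iA_form_inv_beta : exists2 f, iA R varpi q f & l f = (1 - beta^-1)%:F.
Proof.
have fS := ideal_section_series varpi_unif fsph_principal_series 0.
have /iQ_predP fP := fS; exists (MkIQ fP).
  exact: (ideal_section_valued varpi_unif frac_charM frac_char_units
    fsph_principal_series spherical_integers frac_alpha_neq_beta
    integral_fraction1 integral_fractionB integral_fractionM integral_fraction_char).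
rewrite -form_on_functionsE /= (form_ideal_section varpi_unif frac_charM
  frac_char_units form_on_functions_lin form_on_functions_inv
  fsph_principal_series frac_alpha_neq_beta form_fsph).
by rewrite expr0z mul1r frac_beta_inv tofracB tofrac1.
Qed.

Lemma iA_comb (c e : A) (f g : iQ) : iA R varpi q f -> iA R varpi q g ->
  iA R varpi q (c%:F *: f + (e%:F *: g + 0)).
Proof.
move=> fA gA x; have [s sE] := fA x; have [t tE] := gA x.
by exists (c * s + (e * t + 0)); rewrite !iQ_linE sE tE !tofracD !tofracM tofrac0.
Qed.

Lemma form_image :
  [set l f | f in iA R varpi q] =
  [set x%:F | x in ideal2 (1 - beta) (1 - alpha * beta^-1)].
Proof.
apply/seteqP; split=> [_ [f fA <-]|_ [z [x [y ->]] <-]].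
  have [x [y ->]] := form_iA fA.
  exists (x * (1 - alpha * beta^-1) + y * (1 - beta^-1)) => //.
  by apply: ideal2_inv beta_unit _ _; exists x, y.
have [f fA lf] := iA_form_inv_beta.
(* (1 - b) x equals -b x (1 - b^-1), whence the coefficient of f. *)
exists ((- (beta * x))%:F *: f + (y%:F *: fsph + 0)).
  exact: iA_comb fA fsph_iA.
rewrite linearP addr0 linearZ lf l_fsph /=.
rewrite -[LHS]/(_%:F * _%:F + _%:F * _%:F) -!tofracM -tofracD; congr (_%:F).
have : beta * beta^-1 = 1 by rewrite divrr ?beta_unit.
move: beta beta^-1 (1 - _ * _) => e w v ew.
by rewrite mulrBr mulr1 mulNr mulrAC ew; ring.
Qed.

End UnramifiedPrincipalSeries.

(** * The image in terms of the parameters q^(-1/2) X1 and q^(1/2) X2 *)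

Theorem theorem1p1 (R : realType) (p : nat) (p_pr : prime p)
    (F : fieldExtType (padic_field p_pr)) (varpi : F) (q : nat)
    (varpi_unif : uniformizer varpi) (q_card : residue_field F #= `I_q)
    (fsph : iQ R varpi q) (fsphP : spherical fsph)
    (l : {scalar iQ R varpi q}) (l_inv : GL1_invariant l) :
  let A := laurent R[i] in
  let QA := {fraction A} in
  let X1 : A := laurent_X1 R[i] in
  let X2 : A := laurent_X2 R[i] in
  let sqrtq : R[i] := (Num.sqrt (q%:R : R))%:C%C in
  let u : A := 1 - laurentC (q%:R^-1 : R[i]) * X1 * X2^-1 in
  let I1 : set A := ideal2 (1 - laurentC (sqrtq^-1) * X1) u in
  let I2 : set A := ideal2 (1 - laurentC sqrtq * X2) u in
  let L : set QA := [set l f | f in iA R varpi q] in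
  l fsph = u%:F ->
  [/\ L = [set x%:F | x in I1],
      I1 = I2,
      ~ free_submodule (I1 : set A^o),
      L `<=` [set x%:F | x in [set: A]]
    & forall a : A, a != 0 -> a \isn't a GRing.unit ->
        ~ [set (a%:F)^-1 * y | y in L] `<=` [set x%:F | x in [set: A]] ].

Proof.
move=> A QA X1 X2 sqrtq u I1 I2 L lu.
have q1 := residue_card_gt1 varpi_unif q_card.
have sq0 : sqrtq != 0.
  by rewrite fmorph_eq0 gt_eqF// sqrtr_gt0 ltr0n ltnW.
have sqV : sqrtq^-1 * sqrtq^-1 = q%:R^-1.
  rewrite -invfM -rmorphM /= -expr2 sqr_sqrtr ?ler0n//.
  by rewrite rmorph_nat.
pose a := torus_char R varpi q varpi 1; pose b := torus_char R varpi q 1 varpi.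
have aE : a = laurentC sqrtq^-1 * X1 by apply: torus_char1.
have bE : b = laurentC sqrtq * X2 by apply: torus_char2.
have bU : b \is a GRing.unit by rewrite torus_char_unit ?oner_neq0 ?uniformizer_neq0.
(* The factor 1/q in u is the square of [sqrtq^-1], one copy coming from a and one from 1/b. *)
have uE : u = 1 - a * b^-1.
  rewrite /u; congr (1 - _); apply: (mulIr bU); rewrite (divrK bU) aE bE.
  have VX : X2^-1 * X2 = 1 by rewrite mulVr ?laurent_X2_unit.
  have CC : laurentC (q%:R^-1 : R[i]) * laurentC sqrtq = laurentC sqrtq^-1.
    by rewrite -rmorphM -sqV divfK.
  have cancel_v (D : comNzRingType) (c s x v y : D) : v * y = 1 ->
      c * x * v * (s * y) = c * s * x.
    by move=> vy; rewrite mulrACA vy mulr1 mulrAC.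
  by rewrite -CC; apply: cancel_v.
have ab : a != b by rewrite aE bE laurent_X1_neq_X2.
have coprime (v x y : A) : v * x = 1 - a -> v * y = 1 - b -> v \is a GRing.unit.
  by rewrite aE bE; apply: laurent_coprime.
have proper (x y : A) : (1 - a) * x + (1 - b) * y != 1.
  by rewrite aE bE; apply: laurent_ideal_proper; rewrite ?invr_eq0.
have I1E : I1 = ideal2 (1 - a) (1 - a * b^-1) by rewrite /I1 uE aE.
have I2E : I2 = ideal2 (1 - b) (1 - a * b^-1) by rewrite /I2 uE bE.
have I12 : I1 = I2 by rewrite I1E I2E ideal2_exchange.
have LE : L = [set x%:F | x in I1].
  rewrite I12 I2E; apply: (form_image varpi_unif q_card l_inv fsphP ab).
  by rewrite lu uE.
split=> //.
- by rewrite I1E; apply: ideal2_not_free.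
- by rewrite LE => _ [x _ <-]; exists x.
- move=> c c0 /negP cU LA; apply: cU.
  (* If [c^-1 L] lies in A, then c divides every element of the ideal, in particular the coprime 1 -
     a and 1 - b. *)
  have div z : I1 z -> exists x, c * x = z.
    move=> Iz; have [|x _ xE] := LA ((c%:F)^-1 * z%:F).
      by exists z%:F => //; rewrite LE; exists z.
    exists x; apply/eqP; rewrite -tofrac_eq tofracM xE mulrA mulfV ?mul1r//.
    by rewrite tofrac_eq0.
  have [|x xE] := div (1 - a); first by rewrite I1E; apply: ideal2_gen_l.
  have [|y yE] := div (1 - b); first by rewrite I1E; apply: ideal2_gen_r.
  exact: coprime xE yE.
Qed.
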